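(* For all $m,n\in\mathbb Z$, $$T_{m,n}(t)=N_{m,n}\,S_{[\lambda,\mu]}(x,y),$$ where $u=|n-m-\frac12|-\frac12$, $v=|n+m-\frac12|-\frac12$, $\lambda=(u,u-1,\ldots,2,1)$, $\mu=(v,v-1,\ldots,2,1)$ (empty if $u=0$, resp. $v=0$), the variables are specialized as $$x_k=\frac{-\kappa_\infty+\sum_i\theta_it_i^k}{k},\qquad y_k=\frac{-\kappa_\infty+\sum_i\theta_it_i^{-k}}{k}\quad(k=1,2,\dots),$$ and $$N_{m,n}=(-1)^{v(v+1)/2}\prod_{i=1}^Nt_i^{v(v+1)/2}\prod_{j=1}^u(2j-1)!!\prod_{k=1}^v(2k-1)!!.$$
   Context: The special polynomials $T_{m,n}=T_{m,n}(t)$, $t=(t_1,\dots,t_N)$, $m,n\in\mathbb Z$, depending on parameters $\kappa_\infty,\theta_1,\dots,\theta_N$, are determined as follows: put $\Phi(T)=\big(\sum_i\frac{t_i^2-1}{t_i}\frac{\partial}{\partial t_i}-2\big)\sum_it_i(t_i^2-1)\frac{\partial}{\partial t_i}\log T+\kappa_\infty\sum_i\theta_i\frac{t_i^2+1}{t_i}-\frac12\sum_{i,j}\theta_i\theta_j\frac{t_i^2+t_j^2}{t_it_j}-\kappa_\infty^2$ (sum over all ordered pairs $(i,j)$); start from $T_{0,0}=T_{0,1}=1$, $T_{1,0}=\sum_i\theta_it_i-\kappa_\infty$, $T_{1,1}=\prod_it_i(\kappa_\infty-\sum_j\theta_jt_j^{-1})$; obtain $T_{m,0},T_{m,1}$ for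 all $m$ from $T_{m+1,n}T_{m-1,n}=\prod_it_i\{\Phi(T_{m,n})+(2m)^2\}T_{m,n}^2$ (forward and backward in $m$); then all $T_{m,n}$ from $T_{m,n+1}T_{m,n-1}=\prod_it_i\{\Phi(T_{m,n})+(2n-1)^2\}T_{m,n}^2$ (forward and backward in $n$). Universal character: for variables $x=(x_1,x_2,\dots)$ define $p_k(x)$ by $\sum_{k\ge0}p_k(x)z^k=\exp(\sum_{k\ge1}x_kz^k)$ and $p_{-k}=0$ for $k>0$; $q_k(y)$ is the same with $y$ in place of $x$. For partitions $\lambda=(\lambda_1,\dots,\lambda_l)$, $\mu=(\mu_1,\dots,\mu_{l'})$, $S_{[\lambda,\mu]}(x,y)=\det(a_{ij})_{1\le i,j\le l+l'}$ with $a_{ij}=q_{\mu_{l'-i+1}+i-j}(y)$ for $1\le i\le l'$ and $a_{ij}=p_{\lambda_{i-l'}-i+j}(x)$ for $l'+1\le i\le l+l'$. *)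

(* Defs.v *)
From HB Require Import structures.
From mathcomp Require Import all_boot all_order all_algebra.
From mathcomp Require Import mpoly.
Set Implicit Arguments. Unset Strict Implicit. Unset Printing Implicit Defensive.
Import Order.TTheory GRing.Theory Num.Theory.
Local Open Scope ring_scope.

(* The ambient field: K = Q(t_1..t_N, kappa_inf, theta_1..theta_N), the field of
   fractions of {mpoly rat[2N+1]}.  Variable layout:
   'X_i = t_(i+1) (i < N), 'X_N = kappa_inf, 'X_(N+1+i) = theta_(i+1). *)
Section Painleve.
Variable N : nat.
Local Notation V := N.*2.+1.
Local Notation P := {mpoly rat[V]}.
Local Notation K := {fraction P}.

Definition tvar (i : 'I_N) : K := tofrac ('X_(inord i) : P).
Definition kinf : K := tofrac ('X_(inord N) : P).
Definition theta (i : 'I_N) : K := tofrac ('X_(inord (N.+1 + i)) : P).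

Definition dfrac (i : 'I_N) (f : K) : K :=
  let r := repr f in
  tofrac ((mderiv (inord i) (frac r).1) * (frac r).2
          - (frac r).1 * (mderiv (inord i) (frac r).2))
  / tofrac (((frac r).2) ^+ 2).

Definition Phi (T : K) : K :=
  let G := \sum_(i < N) tvar i * (tvar i ^+ 2 - 1) * (dfrac i T / T) in
  \sum_(i < N) (tvar i ^+ 2 - 1) / tvar i * dfrac i G - 2 * G
  + kinf * \sum_(i < N) theta i * (tvar i ^+ 2 + 1) / tvar i
  - 2^-1 * \sum_(i < N) \sum_(j < N)
        theta i * theta j * (tvar i ^+ 2 + tvar j ^+ 2) / (tvar i * tvar j)
  - kinf ^+ 2.

Definition step (c : int) (X : K) : K :=
  (\prod_(i < N) tvar i) * (Phi X + (c%:~R) ^+ 2) * X ^+ 2.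

(* two-sided sequence a : int -> K with a_0, a_1 given and
   a_(j+1) a_(j-1) = F j a_j, solved forward (j >= 1) and backward (j <= 0) *)
Fixpoint fwd (F : int -> K -> K) (a0 a1 : K) (k : nat) : K * K :=
  match k with
  | 0 => (a0, a1)
  | k'.+1 => let pq := fwd F a0 a1 k' in (pq.2, F (k'.+1)%:Z pq.2 / pq.1)
  end.
Fixpoint bwd (F : int -> K -> K) (a0 a1 : K) (k : nat) : K * K :=
  match k with
  | 0 => (a0, a1)
  | k'.+1 => let pq := bwd F a0 a1 k' in (F (- (k'%:Z)) pq.1 / pq.2, pq.1)
  end.
Definition bseq (F : int -> K -> K) (a0 a1 : K) (j : int) : K :=
  match j with
  | Posz k => (fwd F a0 a1 k).1
  | Negz k => (bwd F a0 a1 k.+1).1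
  end.

Definition T10 : K := \sum_(i < N) theta i * tvar i - kinf.
Definition T11 : K := (\prod_(i < N) tvar i) * (kinf - \sum_(j < N) theta j / tvar j).

Definition Tcol0 (m : int) : K := bseq (fun j X => step (2 * j) X) 1 T10 m.
Definition Tcol1 (m : int) : K := bseq (fun j X => step (2 * j) X) 1 T11 m.
Definition Tmn (m n : int) : K :=
  bseq (fun j X => step (2 * j - 1) X) (Tcol0 m) (Tcol1 m) n.

Definition xs (k : nat) : K := (- kinf + \sum_(i < N) theta i * tvar i ^+ k) / k%:R.
Definition ys (k : nat) : K := (- kinf + \sum_(i < N) theta i * (tvar i)^-1 ^+ k) / k%:R.

End Painleve.

Section UniChar.
Variable F : fieldType.

(* p_k(x) = coefficient of z^k in exp(sum_{j>=1} x_j z^j)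
          = prod_j sum_m x_j^m z^(j m) / m!  ;  p_k = 0 for k < 0 *)
Definition schurp (x : nat -> F) (k : int) : F :=
  match k with
  | Posz k => \sum_(e : {ffun 'I_k -> 'I_k.+1} | (\sum_(j < k) j.+1 * e j)%N == k)
                 \prod_(j < k) (x j.+1 ^+ e j / ((e j)`!)%:R)
  | Negz _ => 0
  end.

(* universal character S_[lam,mu](x,y), with 0-based row/column indices *)
Definition unichar (x y : nat -> F) (lam mu : seq nat) : F :=
  let l := size lam in let l' := size mu in
  \det (\matrix_(i < l' + l, j < l' + l)
     if (i < l')%N then schurp y ((nth 0%N mu (l' - i.+1))%:Z + i%:Z - j%:Z)
     else schurp x ((nth 0%N lam (i - l'))%:Z - i%:Z + j%:Z)).
End UniChar.

(* |k - 1/2| - 1/2 for an integer k *)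
Definition ufun (k : int) : nat := if (0 < k) then absz (k - 1) else absz k.

Definition stair (u : nat) : seq nat := rev (iota 1 u).

Fixpoint dfact (n : nat) : nat :=
  match n with
  | 0 => 1%N
  | 1 => 1%N
  | S (S k as k1) => (k.+2 * dfact k)%N
  end.

Definition Nmn (N : nat) (m n : int) : {fraction {mpoly rat[N.*2.+1]}} :=
  let u := ufun (n - m) in let v := ufun (n + m) in
  (-1) ^+ ((v * v.+1) %/ 2) * (\prod_(i < N) tvar i) ^+ ((v * v.+1) %/ 2)
  * ((\prod_(1 <= j < u.+1) dfact (2 * j - 1))%N)%:R
  * ((\prod_(1 <= k < v.+1) dfact (2 * k - 1))%N)%:R.

(* Main.v *)
Require Import Defs.
From HB Require Import structures.
From mathcomp Require Import all_boot all_order all_algebra.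
From mathcomp Require Import mpoly.
From mathcomp Require Import ring zify.
Set Implicit Arguments.
Unset Strict Implicit.
Unset Printing Implicit Defensive.
Import Order.TTheory GRing.Theory Num.Theory.
Local Open Scope ring_scope.

(* Put X_k = - kappa + sum_i theta_i t_i^k for every integer k.  The two vector
   fields in Phi act by D1 X_k = k (X_k - X_(k-2)) and D2 X_k = k (X_(k+2) - X_k),
   and Phi(T) = (D1 - 2) (D2 T / T) - X_1 X_(-1), so the recursions are Toda
   equations for the universal characters of pairs of staircases.

   The rows of the determinant are shifts j |-> p (j - r), j |-> q (s - j), with
   labels r and s in steps of 2.  Hence D2 raises only the largest part of the
   first staircase and D1 that of the second, all other contributions having two
   equal rows; padding both partitions by zero parts turns the remaining column
   shifts into scalars.  The Toda equations then reduce to three-term Pluecker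
   relations.  The denominators of the recursions do not vanish: at t = 1,
   theta = 0, kappa = 1/2 the vector fields act trivially and the Toda equations
   become products with nonzero factors - 1/4 + z^2, z an integer. *)

(** In the coordinates k = n - m and l = n + m the first staircase depends on k only and the second
    on l only; a step in m moves (k, l) by (-1, 1) and a step in n by (1, 1). Since [ufun] is a
    reflection about 1/2, either recursion makes the staircases grow together or makes one grow
    while the other shrinks, according to the sides of 1/2 on which k and l lie. Hence there are two
    Toda equations, with constants (A + B - 1)^2 and (A - B)^2 for A = v + 1, B = u + 1. Their
    difference contains no derivative and follows from column shifts alone, so only one of them has
    to be differentiated.

    The -2 in [Phi] has two effects: it cancels the change in the sum of row labels when a part is
    raised, and it makes [Phi] blind to powers of the product of the t_i, which the normalisation
    contains.

    Division by zero yields 0 in the recursions, so product identities determine the sequences only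
    once every character is known to be nonzero; this is why a specialisation is needed. *)

(** * Complete functions as coefficients of truncated exponentials *)

Section TruncatedExponential.
Variable F : fieldType.

Definition coef_agree (k : nat) (f g : {poly F}) :=
  forall i, (i < k)%N -> f`_i = g`_i.

Lemma coef_agreeM k f f' g g' :
  coef_agree k f f' -> coef_agree k g g' -> coef_agree k (f * g) (f' * g').
Proof.
move=> hf hg i ik; rewrite !coefM; apply: eq_bigr => j _.
have ji := ltn_ord j.
by rewrite hf ?hg //; lia.
Qed.

Lemma coef_agree_prod k n (f g : nat -> {poly F}) :
  (forall j, (j < n)%N -> coef_agree k (f j) (g j)) ->
  coef_agree k (\prod_(j < n) f j) (\prod_(j < n) g j).
Proof.
elim: n => [|n IH] h; first by rewrite !big_ord0.
rewrite !big_ord_recr /=; apply: coef_agreeM; last exact: h.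
by apply: IH => j jn; apply: h; rewrite ltnS ltnW.
Qed.

(** The first [m] terms of exp(c z^d). Polynomials stand in for power series and are compared below
    the order of truncation. *)
Definition truncexp (m : nat) (c : F) (d : nat) : {poly F} :=
  \sum_(e < m) (c ^+ e / e`!%:R) *: 'X^(d * e)%N.

Lemma coef_truncexp m c d i :
  (truncexp m c d)`_i = \sum_(e < m) (c ^+ e / e`!%:R) * (i == (d * e)%N)%:R.
Proof. by rewrite coef_sum; apply: eq_bigr => e _; rewrite coefZ coefXn. Qed.

Lemma truncexp_agree k m m' c d : (0 < d)%N -> (k <= m)%N -> (k <= m')%N ->
  coef_agree k (truncexp m c d) (truncexp m' c d).
Proof.
move=> d0; wlog le_mm': m m' / (m <= m')%N => [hw hm hm'|km _ i ik].
  have [/hw|/ltnW/hw h] := leqP m m'; first exact.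
  by move=> i ik; rewrite h.
rewrite !coef_truncexp.
rewrite (big_ord_widen _ (fun e => (c ^+ e / e`!%:R) * (i == (d * e)%N)%:R) le_mm').
rewrite big_mkcond; apply: eq_bigr => e _.
case: ifP => // /negbT; rewrite -leqNgt => me.
suff /negbTE-> : i != (d * e)%N by rewrite mulr0.
by rewrite neq_ltn (leq_trans ik) ?(leq_trans km) ?(leq_trans me) // leq_pmull.
Qed.

Lemma truncexp_agree1 k m c d : (k <= d)%N -> (0 < m)%N ->
  coef_agree k (truncexp m c d) 1.
Proof.
case: m => // m kd _ i ik; rewrite coef_truncexp coef1 big_ord_recl /= big1.
  by rewrite addr0 muln0 expr0 fact0 divr1 mul1r.
move=> e _; suff /negbTE-> : i != (d * lift ord0 e)%N by rewrite mulr0.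
rewrite neq_ltn (leq_trans ik) // (leq_trans kd) //.
by rewrite lift0 leq_pmulr.
Qed.

(** One term is lost on differentiating, which is why [expprod_deriv] is asserted only to order
    [m]. *)
Lemma deriv_truncexp m c d : (forall k, k.+1%:R != 0 :> F) ->
  (truncexp m.+1 c d.+1)^`() = (d.+1%:R * c) *: 'X^d * truncexp m c d.+1.
Proof.
move=> ch0; rewrite /truncexp raddf_sum big_ord_recl /= muln0 expr0.
rewrite linearZ /= derivC scaler0 add0r mulr_sumr; apply: eq_bigr => e _.
rewrite /bump leq0n add1n derivZ derivXn -scalerAl -scalerAr scalerA -exprD.
rewrite mulnSr addnS /= addnC -scaler_nat scalerA; congr (_ *: _).
have f0 : e`!%:R != 0 :> F by rewrite -[_`!]prednK ?fact_gt0.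
rewrite factS natrM exprS -addSn -mulnS natrM.
move: (ch0 e) (ch0 d); move: (e.+1%:R) (d.+1%:R) => s t s0 t0.
by field; rewrite s0 f0.
Qed.

End TruncatedExponential.

Section CompleteFunctions.
Variables (F : fieldType) (x : nat -> F).
Hypothesis ch0 : forall k, k.+1%:R != 0 :> F.

Definition expprod (n m : nat) : {poly F} :=
  \prod_(j < n) truncexp m.+1 (x j.+1) j.+1.

Lemma schurp_coef (k : nat) : schurp x k = (expprod k k)`_k.
Proof.
(* Expanding the product of sums indexes the terms by the exponent functions of [schurp]. *)
rewrite /expprod /truncexp bigA_distr_bigA coef_sum [LHS]/= big_mkcond.
apply: eq_bigr => e _.
under [in RHS]eq_bigr do rewrite -mul_polyC.
rewrite [in RHS]big_split /= -(rmorph_prod polyC) /= coefCM prodrXr coefXn eq_sym.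
by case: ifP; rewrite ?mulr1 ?mulr0.
Qed.

Lemma expprod_coef n m k : (k <= n)%N -> (k <= m)%N ->
  (expprod n m)`_k = schurp x k.
Proof.
move=> kn km; rewrite schurp_coef.
transitivity (expprod n k)`_k.
  apply: (@coef_agree_prod F k.+1 n (fun j => truncexp m.+1 (x j.+1) j.+1)
    (fun j => truncexp k.+1 (x j.+1) j.+1)) => // j _.
  exact: truncexp_agree.
elim: n kn => [|n IH]; first by rewrite leqn0 => /eqP->.
rewrite leq_eqVlt => /predU1P[->//|]; rewrite ltnS => kn.
rewrite -IH // /expprod big_ord_recr /= -[in RHS](mulr1 (\prod_(_ < n) _)).
by apply: (@coef_agreeM F k.+1) => //; apply: truncexp_agree1.
Qed.

Lemma expprod_deriv n m : coef_agree m (expprod n m)^`()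
  ((\sum_(j < n) (j.+1%:R * x j.+1) *: 'X^j) * expprod n m).
Proof.
elim: n => [|n IH]; first by rewrite /expprod !big_ord0 mul0r derivC.
rewrite /expprod !big_ord_recr /= -/(expprod n m) derivM mulrDl => i im.
rewrite coefD [RHS]coefD; congr (_ + _).
  by rewrite mulrA; apply: coef_agreeM im.
rewrite deriv_truncexp // mulrCA; apply: coef_agreeM im => //.
by apply: coef_agreeM => //; apply: truncexp_agree => //.
Qed.

Lemma schurp0 : schurp x 0%N = 1.
Proof. by rewrite schurp_coef /expprod big_ord0 coef1. Qed.

Lemma schurpN (k : int) : k < 0 -> schurp x k = 0.
Proof. by case: k. Qed.

(** Coefficients in f' = (sum_j j x_j z^(j-1)) f for f = exp(sum_j x_j z^j). *)
Lemma schurp_rec (k : nat) : k.+1%:R * schurp x k.+1 =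
  \sum_(j < k.+1) j.+1%:R * x j.+1 * schurp x (k%:Z - j%:Z).
Proof.
rewrite schurp_coef mulr_natl -coef_deriv expprod_deriv // mulr_suml coef_sum.
apply: eq_bigr => j _; rewrite -scalerAl coefZ coefXnM.
have jk : (j <= k)%N by rewrite -ltnS.
by rewrite ltnNge jk /= expprod_coef -?subzn //; lia.
Qed.

(** The extra terms have negative index and vanish. A length [B] independent of [k] lets such sums
    be added and exchanged for different [k]. *)
Lemma schurp_rec_wide (k : int) (B : nat) : k <= B%:Z ->
  k%:~R * schurp x k = \sum_(j < B) j.+1%:R * x j.+1 * schurp x (k - 1 - j%:Z).
Proof.
case: k => [[|k]|k] kB; last 1 first.
- rewrite /= mulr0 big1 // => j _; rewrite schurpN ?mulr0 //; lia.
- rewrite mul0r big1 // => j _; rewrite schurpN ?mulr0 //; lia.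
have kB' : (k.+1 <= B)%N by lia.
rewrite schurp_rec (big_ord_widen _ (fun j =>
  j.+1%:R * x j.+1 * schurp x (k%:Z - j%:Z)) kB') big_mkcond.
apply: eq_bigr => j _; have -> : k.+1%:Z - 1 - j%:Z = k%:Z - j%:Z by lia.
case: ifP => // /negbT; rewrite -leqNgt => kj.
by rewrite schurpN ?mulr0 //; lia.
Qed.

End CompleteFunctions.

(** * Derivations of a field *)

Section Derivations.
Variable F : fieldType.

Definition derivation (D : F -> F) :=
  {morph D : a b / a + b} /\ (forall a b, D (a * b) = D a * b + a * D b).

Variable D : F -> F.
Hypothesis derD : derivation D.

Lemma derD_add a b : D (a + b) = D a + D b.
Proof. by case: derD => h _; apply: h. Qed.

Lemma derM a b : D (a * b) = D a * b + a * D b.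
Proof. by case: derD => _ h; apply: h. Qed.

Lemma der0 : D 0 = 0.
Proof. by apply: (addIr (D 0)); rewrite -derD_add !add0r. Qed.

Lemma der1 : D 1 = 0.
Proof. by apply: (addIr (D 1)); have := derM 1 1; rewrite !mulr1 mul1r add0r. Qed.

Lemma derN a : D (- a) = - D a.
Proof. by apply: (addIr (D a)); rewrite -derD_add !addNr der0. Qed.

Lemma derB a b : D (a - b) = D a - D b.
Proof. by rewrite derD_add derN. Qed.

Lemma der_nat n : D n%:R = 0.
Proof. by elim: n => [|n IH]; rewrite ?der0 // -natr1 derD_add IH der1 addr0. Qed.

Lemma der_int (n : int) : D n%:~R = 0.
Proof. by case: n => n; rewrite ?NegzE ?mulrNz ?derN der_nat ?oppr0. Qed.

Lemma der_sum (I : Type) (r : seq I) (P : pred I) (f : I -> F) :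
  D (\sum_(i <- r | P i) f i) = \sum_(i <- r | P i) D (f i).
Proof. exact: (big_morph D derD_add der0). Qed.

Lemma derV a : D a^-1 = - D a / a ^+ 2.
Proof.
have [->|a0] := eqVneq a 0; first by rewrite invr0 der0 oppr0 mul0r.
have := derM a a^-1; rewrite divff // der1 => h.
have -> : D a^-1 = - (D a / a) / a.
  apply: (mulfI a0); have -> : a * (- (D a / a) / a) = - (D a / a) by field.
  by apply: (addrI (D a / a)); rewrite subrr.
by field.
Qed.

Lemma derX a n : D (a ^+ n) = n%:R * a ^+ n.-1 * D a.
Proof.
elim: n => [|[|n] IH]; first by rewrite expr0 der1 !mul0r.
  by rewrite expr1 expr0 !mul1r.
rewrite exprS derM IH /= -[in RHS]natr1 exprS.
by ring.
Qed.

Lemma der_exprz a (n : int) : a != 0 -> D (a ^ n) = n%:~R * (a ^ n / a) * D a.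
Proof.
move=> a0; have powV k : k%:R * a ^+ k.-1 = k%:R * (a ^+ k / a).
  by case: k => [|k]; rewrite ?mul0r // exprS [a * _]mulrC mulfK.
case: n => n; first by rewrite -exprnP derX powV.
rewrite NegzE -exprnN derV derX powV mulrNz.
have := expf_neq0 n.+1 a0; move: (a ^+ _) => b b0.
by rewrite -[n.+1%:~R]/n.+1%:R; field; rewrite b0 a0.
Qed.

Lemma der_prod n (f : 'I_n -> F) :
  D (\prod_i f i) = \sum_i \prod_k (if k == i then D (f k) else f k).
Proof.
elim: n f => [|n IH] f; first by rewrite !big_ord0 der1.
rewrite big_ord_recr derM IH [in RHS]big_ord_recr /= mulr_suml.
congr (_ + _).
  apply: eq_bigr => i _; rewrite big_ord_recr /=.
  rewrite [ord_max == _]eq_sym -val_eqE /= ltn_eqF //; congr (_ * _).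
rewrite big_ord_recr /= eqxx; congr (_ * _); apply: eq_bigr => k _.
by rewrite -val_eqE /= ltn_eqF.
Qed.

Lemma der_signr (b : bool) : D ((-1) ^+ b) = 0.
Proof. by case: b; rewrite /= ?expr1 ?expr0 ?derN der1 ?oppr0. Qed.

End Derivations.

(** * Determinants as functions of their rows *)

Section DetRows.
Variable F : fieldType.

Lemma det_row_subst n (A : 'M[F]_n) (k : 'I_n) (w : 'I_n -> F) :
  \det (\matrix_(i, j) if i == k then w j else A i j) =
  \sum_j w j * cofactor A k j.
Proof.
rewrite (expand_det_row _ k); apply: eq_bigr => j _; rewrite mxE eqxx.
congr (_ * (_ * \det _)); apply/matrixP => r s; rewrite !mxE.
by rewrite eq_sym (negbTE (neq_lift _ _)).
Qed.

Lemma cofactor_rowE n (A : 'M[F]_n) k i :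
  \sum_j A k j * cofactor A i j = (k == i)%:R * \det A.
Proof.
have := congr1 (fun B : 'M[F]_n => B k i) (mul_mx_adj A).
rewrite !mxE mulr_natl => <-.
by apply: eq_bigr => j _; rewrite !mxE.
Qed.

Lemma cofactor_colE n (A : 'M[F]_n) l j :
  \sum_i A i l * cofactor A i j = (j == l)%:R * \det A.
Proof.
have := congr1 (fun B : 'M[F]_n => B j l) (mul_adj_mx A).
rewrite !mxE mulr_natl => <-.
by apply: eq_bigr => i _; rewrite !mxE mulrC.
Qed.

(** Jacobi's formula: the product rule on each permutation term differentiates one row at a time. *)
Lemma der_det D n (A : 'M[F]_n) : derivation D ->
  D (\det A) = \sum_i \sum_j D (A i j) * cofactor A i j.
Proof.
move=> derD; rewrite /determinant der_sum //.
under eq_bigr => s _ do rewrite derM // der_signr // mul0r add0r der_prod // mulr_sumr.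
rewrite exchange_big /=; apply: eq_bigr => i _.
rewrite -(det_row_subst _ _ (fun j => D (A i j))); apply: eq_bigr => s _.
congr (_ * _); apply: eq_bigr => k _; rewrite !mxE.
by case: eqP => [->|].
Qed.

Lemma det_row_swap n (A : 'M[F]_n) (i k : 'I_n) : i != k ->
  \det (xrow i k A) = - \det A.
Proof.
move=> ik; rewrite xrowE det_mulmx /tperm_mx det_perm perm.odd_tperm ik expr1.
by rewrite mulN1r.
Qed.

(* Expanding x and y along the rows of an invertible matrix turns the
   three-term relation into the formula for a 2 x 2 determinant. *)
Lemma det_plucker n (A : 'M[F]_n) (i k : 'I_n) (x y : 'I_n -> F) :
  \det A != 0 -> i != k ->
  let rep1 l w := \det (\matrix_(r, s) if r == l then w s else A r s) in
  \det A * \det (\matrix_(r, s) if r == i then x s else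
                               if r == k then y s else A r s) =
  rep1 i x * rep1 k y - rep1 k x * rep1 i y.
Proof.
move=> A0 ik rep1.
have comb (w : 'I_n -> F) : exists a : 'I_n -> F,
    (forall j, w j = \sum_l a l * A l j) /\
    (forall l, rep1 l w = a l * \det A).
  exists (fun l => \sum_j w j * cofactor A l j / \det A); split => [j|l].
    transitivity (\sum_s (w s / \det A) * \sum_l A l j * cofactor A l s).
      under eq_bigr do rewrite cofactor_colE.
      rewrite (bigD1 j) //= big1 => [|s /negbTE->]; last by rewrite mul0r mulr0.
      by rewrite eqxx mul1r addr0 divfK.
    under eq_bigr do rewrite mulr_sumr.
    rewrite exchange_big /=; apply: eq_bigr => l _; rewrite mulr_suml.
    by apply: eq_bigr => s _; ring.
  by rewrite /rep1 det_row_subst -mulr_suml divfK.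
have [a [xE ra]] := comb x.
pose B := \matrix_(r, s) if r == k then y s else A r s.
have expand w : \det (\matrix_(r, s) if r == i then w s else
                               if r == k then y s else A r s) =
     \sum_s w s * cofactor B i s.
  by rewrite -det_row_subst; congr (\det _); apply/matrixP => r s; rewrite !mxE.
rewrite expand.
under eq_bigr => s _ do rewrite xE mulr_suml.
rewrite exchange_big /=.
under eq_bigr => l _.
  under eq_bigr => s _ do rewrite -mulrA.
  rewrite -mulr_sumr.
  over.
have rowB l : l != k ->
    \sum_s A l s * cofactor B i s = (l == i)%:R * rep1 k y.
  move=> lk; rewrite -cofactor_rowE; apply: eq_bigr => s _.
  by rewrite /B mxE (negbTE lk).
(* Here row [i] is row [k] of [A] and row [k] is [y]; exchanging them gives [A] with [y] in row
   [i]. *)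
have rowk : \sum_s A k s * cofactor B i s = - rep1 i y.
  rewrite -expand -(det_row_swap _ ik); congr (\det _).
  apply/matrixP => r s; rewrite !mxE.
  case: perm.tpermP => [->|->|/eqP/negbTE-> /eqP/negbTE->] //.
    by rewrite eqxx eq_sym (negbTE ik).
  by rewrite !eqxx eq_sym (negbTE ik).
rewrite (bigD1 k) //= rowk (bigD1 i) //= rowB // eqxx mul1r big1 => [|l].
  by rewrite !ra; ring.
by case/andP => lk /negbTE li; rewrite rowB // li mul0r mulr0.
Qed.

End DetRows.

(** * The two vector fields on complete functions *)

Section SchurDerivative.
Variables (F : fieldType) (X : int -> F).
Hypothesis ch0 : forall k, k.+1%:R != 0 :> F.

(** The complete symmetric function h_k in terms of power sums X_j. Indexing [X] by all integers
    makes the q_k the same functions of the reversed sequence k |-> X (- k), which exchanges the two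
    vector fields up to sign. *)
Definition complete (k : int) : F := schurp (fun j => X j%:Z / j%:R) k.
Local Notation p := complete.

Lemma complete0 : p 0 = 1.
Proof. exact: schurp0. Qed.

Lemma completeN k : k < 0 -> p k = 0.
Proof. exact: schurpN. Qed.

Lemma complete_rec (k : int) (B : nat) : k <= B%:Z ->
  k%:~R * p k = \sum_(j < B) X j.+1%:Z * p (k - 1 - j%:Z).
Proof.
move=> kB; rewrite /p (schurp_rec_wide _ ch0 kB); apply: eq_bigr => j _.
by rewrite mulrCA divff // mulr1.
Qed.

Lemma complete1 : p 1 = X 1.
Proof.
have := @complete_rec 1 1%N (lexx _).
by rewrite big_ord1 mul1r complete0 mulr1.
Qed.

Lemma complete2 : 2%:R * p 2 = X 2 + X 1 ^+ 2.
Proof.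
have := @complete_rec 2 2%N (lexx _).
rewrite !big_ord_recl big_ord0 => ->.
transitivity (X 1 * p 1 + (X 2 * p 0 + 0)).
  by congr (X _ * p _ + (X _ * p _ + _)).
by rewrite complete0 complete1; ring.
Qed.

Lemma intr_neq0 (k : int) : k != 0 -> k%:~R != 0 :> F.
Proof.
case: k => [[|k]|k] // _; first exact: ch0.
by rewrite NegzE mulrNz oppr_eq0; apply: ch0.
Qed.

Variable D : F -> F.
Hypothesis derD : derivation D.

(** The chain rule with dp_k/dx_j = p_(k-j), obtained by induction from the recursion instead of
    from the explicit sum. *)
Lemma der_complete (k : int) (B : nat) : k <= B%:Z ->
  D (p k) = \sum_(j < B) (D (X j.+1%:Z) / j.+1%:R) * p (k - 1 - j%:Z).
Proof.
have neg (l : int) : l <= 0 ->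
    D (p l) = \sum_(j < B) (D (X j.+1%:Z) / j.+1%:R) * p (l - 1 - j%:Z).
  move=> l0; rewrite big1 => [|j _]; last by rewrite completeN ?mulr0 //; lia.
  have [->|ln0] := eqVneq l 0; first by rewrite complete0 der1.
  by rewrite completeN ?der0 //; lia.
suff main n : forall l : int, l <= n%:Z -> l <= B%:Z ->
    D (p l) = \sum_(j < B) (D (X j.+1%:Z) / j.+1%:R) * p (l - 1 - j%:Z).
  by move=> kB; apply: (main B).
elim: n => [|n IH] l ln lB; first exact: neg.
have [/neg//|l0] := boolP (l <= 0).
have l0' : l%:~R != 0 :> F by apply: intr_neq0; lia.
apply: (mulfI l0').
have := congr1 D (complete_rec lB).
rewrite derM // der_int // mul0r add0r der_sum // => ->.
transitivity (\sum_(j < B) (j.+1%:R * (D (X j.+1%:Z) / j.+1%:R) * p (l - 1 - j%:Z)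
   + \sum_(i < B) X j.+1%:Z *
      ((D (X i.+1%:Z) / i.+1%:R) * p (l - 1 - j%:Z - 1 - i%:Z)))).
  apply: eq_bigr => j _; rewrite derM // mulrCA divff // mulr1; congr (_ + _).
  by rewrite -mulr_sumr IH //; lia.
(* After the exchange the inner sum is the recursion for p (l - 1 - j); its factor l - 1 - j and the
   factor j + 1 add up to l. *)
rewrite big_split /= [X in _ + X]exchange_big /= -big_split mulr_sumr /=.
apply: eq_bigr => j _.
transitivity ((D (X j.+1%:Z) / j.+1%:R) * (j.+1%:R * p (l - 1 - j%:Z) +
   \sum_(i < B) X i.+1%:Z * p ((l - 1 - j%:Z) - 1 - i%:Z))).
  rewrite mulrDr mulr_sumr; congr (_ + _); first by ring.
  apply: eq_bigr => i _; rewrite mulrCA.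
  by have -> : l - 1 - i%:Z - 1 - j%:Z = l - 1 - j%:Z - 1 - i%:Z by ring.
rewrite -complete_rec; last by lia.
have -> : (l - 1 - j%:Z)%:~R = l%:~R - j.+1%:R :> F.
  by rewrite -addrA -opprD intrB; congr (_ - _); rewrite -natz -[1 in LHS]/(1%:Z) -PoszD.
by ring.
Qed.

(** The terms X_(j+2) p_(k-j) form the recursion for p (k + 2) without its first two terms; the
    terms X_j p_(k-j) form the one for p k. *)
Lemma der_complete_up : (forall k : int, D (X k) = k%:~R * (X (k + 2) - X k)) ->
  forall k, D (p k) = (k + 2)%:~R * p (k + 2) - X 1 * p (k + 1)
                      - (X 2 + k%:~R) * p k.
Proof.
move=> DX k.
have kB : k <= `|k|%N%:Z by lia.
have kB2 : k + 2 <= `|k|%N.+2%:Z by lia.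
rewrite (der_complete kB) (complete_rec kB2) mulrDl (complete_rec kB).
rewrite 2!big_ord_recl /= /bump /= !add1n.
have -> : k + 2 - 1 - 0%N%:Z = k + 1 by lia.
have -> : k + 2 - 1 - 1%N%:Z = k by lia.
have -> : \sum_(j < `|k|%N) D (X j.+1%:Z) / j.+1%:R * p (k - 1 - j%:Z) =
  \sum_(j < `|k|%N) X j.+3%:Z * p (k - 1 - j%:Z)
  - \sum_(j < `|k|%N) X j.+1%:Z * p (k - 1 - j%:Z).
  rewrite -sumrB; apply: eq_bigr => j _; rewrite DX -mulrBl; congr (_ * _).
  by rewrite pmulrn [_ * (_ - _)]mulrC mulfK ?intr_neq0 //; congr (X _ - _); lia.
have -> : \sum_(i < `|k|%N) X i.+3%:Z * p (k + 2 - 1 - i.+2%:Z) =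
          \sum_(j < `|k|%N) X j.+3%:Z * p (k - 1 - j%:Z).
  by apply: eq_bigr => j _; congr (_ * p _); lia.
by ring.
Qed.

(** The terms X_(j-2) p_(k-j) form the recursion for p (k - 2), preceded by two terms with X_(-1)
    and X_0. *)
Lemma der_complete_down : (forall k : int, D (X k) = k%:~R * (X k - X (k - 2))) ->
  forall k, D (p k) = k%:~R * p k - ((k - 2)%:~R + X 0) * p (k - 2)
                      - X (-1) * p (k - 1).
Proof.
move=> DX k.
have kB : k <= `|k|%N.+2%:Z by lia.
have kB2 : k - 2 <= `|k|%N%:Z by lia.
rewrite (der_complete kB) (complete_rec kB) mulrDl (complete_rec kB2).
have -> : \sum_(j < `|k|%N.+2) D (X j.+1%:Z) / j.+1%:R * p (k - 1 - j%:Z) =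
  \sum_(j < `|k|%N.+2) X j.+1%:Z * p (k - 1 - j%:Z)
  - \sum_(j < `|k|%N.+2) X (j%:Z - 1) * p (k - 1 - j%:Z).
  rewrite -sumrB; apply: eq_bigr => j _; rewrite DX -mulrBl; congr (_ * _).
  by rewrite pmulrn [_ * (_ - _)]mulrC mulfK ?intr_neq0 //; congr (_ - X _); lia.
rewrite 2![in X in _ - X]big_ord_recl /= /bump /= !add1n.
have -> : k - 1 - 0%N%:Z = k - 1 by lia.
have -> : k - 1 - 1%N%:Z = k - 2 by lia.
have -> : \sum_(i < `|k|%N) X (i.+2%:Z - 1) * p (k - 1 - i.+2%:Z) =
          \sum_(j < `|k|%N) X j.+1%:Z * p (k - 2 - 1 - j%:Z).
  by apply: eq_bigr => j _; congr (X _ * p _); lia.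
have -> : 0%N%:Z - 1 = -1 by [].
have -> : 1%N%:Z - 1 = 0 by [].
by ring.
Qed.

End SchurDerivative.

Arguments complete {F} X k : simpl never.

Section SparseSums.
Variable F : fieldType.

Lemma sum_ord1 M (G : nat -> F) k : (k < M)%N ->
  (forall i, (i < M)%N -> i != k -> G i = 0) -> \sum_(i < M) G i = G k.
Proof.
move=> kM G0; rewrite (bigD1 (Ordinal kM)) //= big1 ?addr0 // => i ik.
exact: G0.
Qed.

Lemma sum_ord2 M (G : nat -> F) k l : (k < M)%N -> (l < M)%N -> k != l ->
  (forall i, (i < M)%N -> i != k -> i != l -> G i = 0) ->
  \sum_(i < M) G i = G k + G l.
Proof.
move=> kM lM kl G0; rewrite (bigD1 (Ordinal kM)) //=; congr (_ + _).
rewrite (bigD1 (Ordinal lM)) /=; last by rewrite -val_eqE eq_sym.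
by rewrite big1 ?addr0 // => i /andP[ik il]; apply: G0.
Qed.

Lemma sum_ord3 M (G : nat -> F) k l r :
  (k < M)%N -> (l < M)%N -> (r < M)%N -> k != l -> k != r -> l != r ->
  (forall i, (i < M)%N -> i != k -> i != l -> i != r -> G i = 0) ->
  \sum_(i < M) G i = G k + G l + G r.
Proof.
move=> kM lM rM kl kr lr G0; rewrite (bigD1 (Ordinal kM)) //= -addrA.
congr (_ + _); rewrite (bigD1 (Ordinal lM)) /=; last by rewrite -val_eqE eq_sym.
congr (_ + _); rewrite (bigD1 (Ordinal rM)) /=; last first.
  by rewrite -!val_eqE /= eq_sym kr eq_sym lr.
by rewrite big1 ?addr0 // => i /andP[/andP[ik il] ir]; apply: G0.
Qed.

End SparseSums.

(** * Determinants with labelled rows and their shifts *)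

Section LabelledDeterminants.
Variables (F : fieldType) (p q : int -> F).

(* The label (true, r) stands for the row j |-> p (j - r) and (false, s) for
   j |-> q (s - j); the column index j may be any integer. *)
Definition label := (bool * int)%type.
Definition lrow (l : label) (j : int) : F :=
  if l.1 then p (j - l.2) else q (l.2 - j).
Definition lshift (c : int) (l : label) : label := (l.1, l.2 + c).
Definition lupd (L : nat -> label) (k : nat) (l : label) : nat -> label :=
  fun i => if i == k then l else L i.
Definition lmx (M : nat) (L : nat -> label) : 'M[F]_M :=
  \matrix_(i < M, j < M) lrow (L i) j%:Z.
Definition ldet (M : nat) (L : nat -> label) : F := \det (lmx M L).
Definition lcof (m : nat) (L : nat -> label) (i j : nat) : F :=
  cofactor (lmx m.+1 L) (inord i) (inord j).

Implicit Types (L : nat -> label) (l : label).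

Lemma lrow_shift c l j : lrow (lshift c l) j = lrow l (j - c).
Proof.
rewrite /lrow /lshift /=; case: ifP => _; congr (_ _); first by ring.
by ring.
Qed.

Lemma ldet_ext M L L' : (forall i, (i < M)%N -> L i = L' i) ->
  ldet M L = ldet M L'.
Proof.
by move=> h; congr (\det _); apply/matrixP => i j; rewrite !mxE h.
Qed.

Lemma lcof_rowE m L k i : (k <= m)%N -> (i <= m)%N ->
  \sum_(j < m.+1) lrow (L k) j%:Z * lcof m L i j = (k == i)%:R * ldet m.+1 L.
Proof.
move=> km im; have := cofactor_rowE (lmx m.+1 L) (inord k) (inord i).
rewrite -val_eqE /= !inordK // => <-.
by apply: eq_bigr => j _; rewrite /lcof inord_val mxE inordK.
Qed.

Lemma lcof_colE m L (l j : nat) : (l <= m)%N -> (j <= m)%N ->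
  \sum_(i < m.+1) lrow (L i) l%:Z * lcof m L i j = (j == l)%:R * ldet m.+1 L.
Proof.
move=> lm jm; have := cofactor_colE (lmx m.+1 L) (inord l) (inord j).
rewrite -val_eqE /= !inordK // => <-.
by apply: eq_bigr => i _; rewrite /lcof inord_val mxE inordK.
Qed.

Lemma ldet_updE m L k l : (k <= m)%N ->
  ldet m.+1 (lupd L k l) = \sum_(j < m.+1) lrow l j%:Z * lcof m L k j.
Proof.
move=> km; transitivity (\det (\matrix_(i < m.+1, j < m.+1)
   if i == inord k then lrow l j%:Z else lmx m.+1 L i j)).
  congr (\det _); apply/matrixP => i j; rewrite !mxE /lupd.
  by rewrite -val_eqE /= inordK //; case: ifP.
rewrite (det_row_subst _ _ (fun j : 'I_m.+1 => lrow l j%:Z)).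
by apply: eq_bigr => j _; rewrite /lcof inord_val.
Qed.

Lemma ldet_upd_row m L k i : (k <= m)%N -> (i <= m)%N -> i != k ->
  ldet m.+1 (lupd L k (L i)) = 0.
Proof.
by move=> km im ik; rewrite ldet_updE // lcof_rowE // (negbTE ik) mul0r.
Qed.

Lemma ldet_upd0 m L k l : (k <= m)%N ->
  (forall j : nat, (j <= m)%N -> lrow l j = 0) -> ldet m.+1 (lupd L k l) = 0.
Proof.
move=> km l0; rewrite ldet_updE // big1 // => j _.
by rewrite l0 ?mul0r // -ltnS.
Qed.

Lemma der_ldet D m L : derivation D -> D (ldet m.+1 L) =
  \sum_(i < m.+1) \sum_(j < m.+1) D (lrow (L i) j%:Z) * lcof m L i j.
Proof.
move=> derD; rewrite /ldet der_det //; apply: eq_bigr => i _.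
by apply: eq_bigr => j _; rewrite mxE /lcof !inord_val.
Qed.

(** Read by columns, the double sum consists of determinants with one column shifted, most of which
    repeat another column. *)
Lemma sum_lcof_colshift m L (c : int) (w : nat -> F) :
  \sum_(i < m.+1) \sum_(j < m.+1) w j * lrow (L i) (j%:Z + c) * lcof m L i j =
  \sum_(j < m.+1) w j * \sum_(i < m.+1) lrow (L i) (j%:Z + c) * lcof m L i j.
Proof.
rewrite exchange_big; apply: eq_bigr => j _; rewrite mulr_sumr.
by apply: eq_bigr => i _; rewrite mulrA.
Qed.

(** The same kind of sum read by rows: moving the column index by [c] moves the row label by
    [- c]. *)
Lemma sum_lcof_rowshift m L (c : int) (w : nat -> F) :
  \sum_(i < m.+1) \sum_(j < m.+1) w i * lrow (L i) (j%:Z + c) * lcof m L i j =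
  \sum_(i < m.+1) w i * ldet m.+1 (lupd L i (lshift (- c) (L i))).
Proof.
apply: eq_bigr => i _; have im : (i <= m)%N by rewrite -ltnS.
rewrite ldet_updE // mulr_sumr.
by apply: eq_bigr => j _; rewrite lrow_shift opprK mulrA.
Qed.

Lemma sum_lcof_col m L (w : nat -> F) :
  \sum_(i < m.+1) \sum_(j < m.+1) w j * lrow (L i) j%:Z * lcof m L i j =
  (\sum_(j < m.+1) w j) * ldet m.+1 L.
Proof.
rewrite exchange_big mulr_suml; apply: eq_bigr => j _.
have jm : (j <= m)%N by rewrite -ltnS.
have := lcof_colE L jm jm; rewrite eqxx mul1r => <-.
by rewrite mulr_sumr; apply: eq_bigr => i _; rewrite mulrA.
Qed.

Lemma sum_lcof_row m L (w : nat -> F) :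
  \sum_(i < m.+1) \sum_(j < m.+1) w i * lrow (L i) j%:Z * lcof m L i j =
  (\sum_(i < m.+1) w i) * ldet m.+1 L.
Proof.
rewrite mulr_suml; apply: eq_bigr => i _.
have im : (i <= m)%N by rewrite -ltnS.
have := lcof_rowE L im im; rewrite eqxx mul1r => <-.
by rewrite mulr_sumr; apply: eq_bigr => j _; rewrite mulrA.
Qed.

Hypothesis p0 : p 0 = 1.
Hypothesis pN : forall k, k < 0 -> p k = 0.
Hypothesis q0 : q 0 = 1.
Hypothesis qN : forall k, k < 0 -> q k = 0.

(** The last row is (0, ..., 0, 1), so pairing it with the cofactors of row [i] leaves only the last
    one. *)
Lemma lcof_top m L i : (i <= m.+1)%N -> L m.+1 = (true, m.+1%:Z) ->
  lcof m.+1 L i m.+1 = (m.+1 == i)%:R * ldet m.+2 L.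
Proof.
move=> im Lm; rewrite -lcof_rowE // big_ord_recr /= big1 ?add0r => [|j _].
  by rewrite Lm /lrow /= subrr p0 mul1r.
by rewrite Lm /lrow /= pN ?mul0r //; have := ltn_ord j; lia.
Qed.

(** Row [m] is (0, ..., 0, 1, p 1), and the cofactor in the last column is already known. *)
Lemma lcof_top2 m L i : (i <= m.+1)%N -> L m.+1 = (true, m.+1%:Z) ->
  L m = (true, m%:Z) ->
  lcof m.+1 L i m = ((m == i)%:R - p 1 * (m.+1 == i)%:R) * ldet m.+2 L.
Proof.
move=> im Lm1 Lm; rewrite mulrBl -lcof_rowE // -mulrA -lcof_top //.
rewrite big_ord_recr big_ord_recr /= big1 ?add0r => [|j _].
  rewrite Lm /lrow /= subrr p0 mul1r.
  by rewrite (_ : m.+1%:Z - m%:Z = 1) ?addrK //; lia.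
by rewrite Lm /lrow /= pN ?mul0r //; have := ltn_ord j; lia.
Qed.

Lemma lcof_bot m L i : (i <= m.+1)%N -> L 0%N = (false, 0) ->
  lcof m.+1 L i 0%N = (0%N == i)%:R * ldet m.+2 L.
Proof.
move=> im L0; rewrite -lcof_rowE // big_ord_recl /= big1 ?addr0 => [|j _].
  by rewrite L0 /lrow /= subrr q0 mul1r.
by rewrite L0 /lrow /= qN ?mul0r //; rewrite /bump /=; lia.
Qed.

Lemma lcof_bot2 m L i : (i <= m.+1)%N -> L 0%N = (false, 0) ->
  L 1%N = (false, 1) ->
  lcof m.+1 L i 1%N = ((1%N == i)%:R - q 1 * (0%N == i)%:R) * ldet m.+2 L.
Proof.
move=> im L0 L1; rewrite mulrBl -lcof_rowE // -mulrA -lcof_bot //.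
rewrite 2!big_ord_recl /= big1 ?addr0 => [|j _].
  rewrite L1 /lrow /= !subr0 /bump /= addn0.
  rewrite (_ : 1 - 1%N%:Z = 0) // q0 mul1r.
  by rewrite [X in X - _]addrC addrK.
by rewrite L1 /lrow /= qN ?mul0r //; rewrite /bump /=; lia.
Qed.

(** Column j shifted by 2 repeats column j + 2 unless j is one of the last two; there the cofactors
    vanish outside the two rows of zero parts. *)
Lemma colshift_top m L (w : nat -> F) : L m.+1 = (true, m.+1%:Z) ->
  L m = (true, m%:Z) ->
  \sum_(i < m.+2) \sum_(j < m.+2) w j * lrow (L i) (j%:Z + 2) * lcof m.+1 L i j =
  (w m * (p 2 - p 1 ^+ 2) + w m.+1 * p 2) * ldet m.+2 L.
Proof.
move=> Lm1 Lm; rewrite sum_lcof_colshift 2!big_ord_recr /= big1 ?add0r; last first.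
  move=> j _; have jm := ltn_ord j.
  have -> : j%:Z + 2 = j.+2%:Z by lia.
  by rewrite lcof_colE ?mulr_natl ?ltn_eqF ?mulr0 //; lia.
rewrite mulrDl -2!mulrA; congr (_ * _ + _ * _).
  rewrite (@sum_ord2 F _ (fun i => lrow (L i) (m%:Z + 2) * lcof m.+1 L i m) m m.+1) //.
  - rewrite !lcof_top2 // !eqxx Lm Lm1 /lrow /=.
    rewrite (_ : m%:Z + 2 - m%:Z = 2); last by ring.
    rewrite (_ : m%:Z + 2 - m.+1%:Z = 1); last by lia.
    rewrite (gtn_eqF (ltnSn m)) (ltn_eqF (ltnSn m)) /=.
    by ring.
  - by rewrite neq_ltn leqnn.
  move=> i im i1 i2; rewrite lcof_top2 // eq_sym (negbTE i1) eq_sym (negbTE i2).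
  by rewrite mulr0 subrr mul0r mulr0.
rewrite (@sum_ord1 F _ (fun i => lrow (L i) (m.+1%:Z + 2) * lcof m.+1 L i m.+1) m.+1) //.
  rewrite lcof_top // eqxx mul1r Lm1 /lrow /=.
  by rewrite (_ : m.+1%:Z + 2 - m.+1%:Z = 2) //; ring.
by move=> i im i1; rewrite lcof_top // eq_sym (negbTE i1) mul0r mulr0.
Qed.

Lemma colshift1_top m L : L m.+1 = (true, m.+1%:Z) ->
  \sum_(i < m.+2) \sum_(j < m.+2) lrow (L i) (j%:Z + 1) * lcof m.+1 L i j =
  p 1 * ldet m.+2 L.
Proof.
move=> Lm1; rewrite exchange_big big_ord_recr /= big1 ?add0r; last first.
  move=> j _; have jm := ltn_ord j.
  have -> : j%:Z + 1 = j.+1%:Z by lia.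
  by rewrite lcof_colE ?mulr_natl ?ltn_eqF ?mulr0 //; lia.
rewrite (@sum_ord1 F _ (fun i => lrow (L i) (m.+1%:Z + 1) * lcof m.+1 L i m.+1) m.+1) //.
  rewrite lcof_top // eqxx mul1r Lm1 /lrow /=.
  by rewrite (_ : m.+1%:Z + 1 - m.+1%:Z = 1) //; ring.
by move=> i im i1; rewrite lcof_top // eq_sym (negbTE i1) mul0r mulr0.
Qed.

Lemma colshift_bot m L (w : nat -> F) : L 0%N = (false, 0) ->
  L 1%N = (false, 1) ->
  \sum_(i < m.+2) \sum_(j < m.+2) w j * lrow (L i) (j%:Z - 2) * lcof m.+1 L i j =
  (w 0%N * q 2 + w 1%N * (q 2 - q 1 ^+ 2)) * ldet m.+2 L.
Proof.
move=> L0 L1; rewrite sum_lcof_colshift 2!big_ord_recl /= [X in _ + (_ + X)]big1 ?addr0; last first.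
  move=> j _; have jm := ltn_ord j; rewrite /bump /= ?add1n.
    have -> : j.+2%:Z - 2 = j%:Z by lia.
  by rewrite lcof_colE ?mulr_natl ?gtn_eqF ?mulr0 //; lia.
rewrite /bump /= ?addn0.
rewrite mulrDl -2!mulrA; congr (_ * _ + _ * _).
  rewrite (@sum_ord1 F _ (fun i => lrow (L i) (0%N%:Z - 2) * lcof m.+1 L i 0%N) 0%N) //.
    by rewrite lcof_bot // eqxx mul1r L0 /lrow.
  by move=> i im i1; rewrite lcof_bot // eq_sym (negbTE i1) mul0r mulr0.
rewrite (@sum_ord2 F _ (fun i => lrow (L i) (1%N%:Z - 2) * lcof m.+1 L i 1%N) 1%N 0%N) //.
  rewrite !lcof_bot2 // L0 L1 /lrow /=.
  rewrite (_ : 1 - (1%N%:Z - 2) = 2) // (_ : 0 - (1%N%:Z - 2) = 1) //.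
  by ring.
move=> i im i1 i2; rewrite lcof_bot2 // eq_sym (negbTE i1) eq_sym (negbTE i2).
by rewrite mulr0 subrr mul0r mulr0.
Qed.

Lemma colshift1_bot m L : L 0%N = (false, 0) ->
  \sum_(i < m.+2) \sum_(j < m.+2) lrow (L i) (j%:Z - 1) * lcof m.+1 L i j =
  q 1 * ldet m.+2 L.
Proof.
move=> L0; rewrite exchange_big big_ord_recl /= [X in _ + X]big1 ?addr0; last first.
  move=> j _; have jm := ltn_ord j; rewrite /bump /= ?add1n.
  have -> : j.+1%:Z - 1 = j%:Z by lia.
  by rewrite lcof_colE ?mulr_natl ?gtn_eqF ?mulr0 //; lia.
rewrite (@sum_ord1 F _ (fun i => lrow (L i) (0%N%:Z - 1) * lcof m.+1 L i 0%N) 0%N) //.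
  by rewrite lcof_bot // eqxx mul1r L0 /lrow.
by move=> i im i1; rewrite lcof_bot // eq_sym (negbTE i1) mul0r mulr0.
Qed.

End LabelledDeterminants.

(** * The vector fields on labelled determinants *)

Section LabelledDerivatives.
Variables (F : fieldType) (X : int -> F) (D1 D2 : F -> F).
Hypothesis ch0 : forall k, k.+1%:R != 0 :> F.
Hypothesis derD1 : derivation D1.
Hypothesis derD2 : derivation D2.
Hypothesis D1X : forall k : int, D1 (X k) = k%:~R * (X k - X (k - 2)).
Hypothesis D2X : forall k : int, D2 (X k) = k%:~R * (X (k + 2) - X k).

Local Notation p := (complete X).
Local Notation q := (complete (fun k => X (- k))).
Local Notation row := (lrow p q).
Local Notation det := (ldet p q).

Let p0 : p 0 = 1. Proof. exact: complete0. Qed.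
Let pN k : k < 0 -> p k = 0. Proof. exact: completeN. Qed.
Let q0 : q 0 = 1. Proof. exact: complete0. Qed.
Let qN k : k < 0 -> q k = 0. Proof. exact: completeN. Qed.

(** On the [q] rows, built from the reversed sequence, the downward rule applies. Both kinds of rows
    are brought to one form, apart from the last term. *)
Lemma D2_row (l : label) (j : int) : D2 (row l j) =
  (j - l.2 + 2)%:~R * row l (j + 2) - (j - l.2)%:~R * row l j
  - X 1 * row l (j + 1) - (if l.1 then X 2 * row l j else X 0 * row l (j + 2)).
Proof.
case: l => [[] r]; rewrite /lrow /=.
  rewrite der_complete_up //.
  have -> : j + 2 - r = j - r + 2 by ring.
  have -> : j + 1 - r = j - r + 1 by ring.
  by ring.
rewrite der_complete_down // => [|k]; last first.
  by rewrite D2X intrN (_ : - (k - 2) = - k + 2); ring.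
have -> : r - (j + 2) = r - j - 2 by ring.
have -> : r - (j + 1) = r - j - 1 by ring.
by rewrite opprK oppr0 !intrD !intrN; ring.
Qed.

Lemma D1_row (l : label) (j : int) : D1 (row l j) =
  (j - l.2)%:~R * row l j - (j - l.2 - 2)%:~R * row l (j - 2)
  - X (-1) * row l (j - 1) - (if l.1 then X 0 * row l (j - 2) else X (-2) * row l j).
Proof.
case: l => [[] r]; rewrite /lrow /=.
  rewrite der_complete_down //.
  have -> : j - 2 - r = j - r - 2 by ring.
  have -> : j - 1 - r = j - r - 1 by ring.
  by ring.
rewrite der_complete_up // => [|k]; last first.
  by rewrite D1X intrN (_ : - (k + 2) = - k - 2); ring.
have -> : r - (j - 2) = r - j + 2 by ring.
have -> : r - (j - 1) = r - j + 1 by ring.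
by rewrite !intrD !intrN; ring.
Qed.

Definition rowsum M (L : nat -> label) : F := \sum_(i < M) ((L i).2)%:~R.
Definition colsum M : F := \sum_(i < M) (i : nat)%:R.

Lemma D2_det m (L : nat -> label) : L m.+1 = (true, m.+1%:Z) ->
  L m = (true, m%:Z) ->
  D2 (det m.+2 L) =
  (m.+2%:R * (p 2 - p 1 ^+ 2) + m.+3%:R * p 2
   + (rowsum m.+2 L - colsum m.+2) - X 1 * p 1
   - X 2 * \sum_(i < m.+2) (L i).1%:R) * det m.+2 L
  - \sum_(i < m.+2) (((L i).2)%:~R + X 0 * (~~ (L i).1)%:R)
      * det m.+2 (lupd L i (lshift (-2) (L i))).
Proof.
move=> Lm1 Lm; rewrite der_ldet //.
set cf := lcof p q m.+1 L.
pose r i : F := ((L i).2)%:~R; pose e i : F := (~~ (L i).1)%:R.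
(* The factor j - r + 2 of the entry shifted by 2 is divided: j + 2 is summed by columns and gives
   scalars, while r, together with the X 0 term, is summed by rows and gives row shifts. *)
transitivity (
  \sum_(i < m.+2) \sum_(j < m.+2) r i * row (L i) j%:Z * cf i j
  + \sum_(i < m.+2) \sum_(j < m.+2) j.+2%:R * row (L i) (j%:Z + 2) * cf i j
  - \sum_(i < m.+2) \sum_(j < m.+2) (r i + X 0 * e i) * row (L i) (j%:Z + 2) * cf i j
  - \sum_(i < m.+2) \sum_(j < m.+2) j%:R * row (L i) j%:Z * cf i j
  - X 1 * \sum_(i < m.+2) \sum_(j < m.+2) row (L i) (j%:Z + 1) * cf i j
  - X 2 * \sum_(i < m.+2) \sum_(j < m.+2) (L i).1%:R * row (L i) j%:Z * cf i j).
  rewrite !mulr_sumr -big_split -!sumrB; apply: eq_bigr => i _.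
  rewrite !mulr_sumr -big_split -!sumrB; apply: eq_bigr => j _ /=.
  rewrite D2_row /r /e; case: (L i) => b s /=.
  have -> : (j%:Z - s + 2)%:~R = j.+2%:R - s%:~R :> F.
    by rewrite !intrD intrN -[j.+2%:R]natr1 -[j.+1%:R]natr1 -pmulrn; ring.
  rewrite intrD intrN -pmulrn.
  by case: b => /=; ring.
rewrite (sum_lcof_row p q _ _ r) (colshift_top q p0 pN (fun j => j.+2%:R) Lm1 Lm).
rewrite (sum_lcof_rowshift p q _ _ 2 (fun i => r i + X 0 * e i)).
rewrite (sum_lcof_col p q _ _ (fun j => j%:R)) (colshift1_top q p0 pN Lm1).
rewrite (sum_lcof_row p q _ _ (fun i => (L i).1%:R)) /rowsum /colsum -/r -/e.
by ring.
Qed.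

(** The column shift with weight 1, read in both ways; it later eliminates one of two surviving row
    shifts. *)
Lemma sum_det_up m (L : nat -> label) : L m.+1 = (true, m.+1%:Z) ->
  L m = (true, m%:Z) ->
  \sum_(i < m.+2) det m.+2 (lupd L i (lshift (-2) (L i))) =
  (p 2 *+ 2 - p 1 ^+ 2) * det m.+2 L.
Proof.
move=> Lm1 Lm.
have := sum_lcof_rowshift p q m.+1 L 2 (fun=> 1).
rewrite (colshift_top q p0 pN (fun=> 1) Lm1 Lm).
under [in X in _ = X -> _]eq_bigr do rewrite mul1r.
by move=> <-; ring.
Qed.

Lemma D1_det m (L : nat -> label) : L 0%N = (false, 0) -> L 1%N = (false, 1) ->
  D1 (det m.+2 L) =
  (q 2 *+ 3 - q 1 ^+ 2 + (colsum m.+2 - rowsum m.+2 L) - X (-1) * q 1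
   - X (-2) * \sum_(i < m.+2) (~~ (L i).1)%:R) * det m.+2 L
  + \sum_(i < m.+2) (((L i).2)%:~R - X 0 * (L i).1%:R)
      * det m.+2 (lupd L i (lshift 2 (L i))).
Proof.
move=> L0 L1; rewrite der_ldet //.
set cf := lcof p q m.+1 L.
pose r i : F := ((L i).2)%:~R; pose e i : F := (L i).1%:R.
transitivity (
  \sum_(i < m.+2) \sum_(j < m.+2) j%:R * row (L i) j%:Z * cf i j
  + \sum_(i < m.+2) \sum_(j < m.+2) (r i - X 0 * e i) * row (L i) (j%:Z - 2) * cf i j
  - \sum_(i < m.+2) \sum_(j < m.+2) (j%:R - 2%:R) * row (L i) (j%:Z - 2) * cf i j
  - \sum_(i < m.+2) \sum_(j < m.+2) r i * row (L i) j%:Z * cf i j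
  - X (-1) * \sum_(i < m.+2) \sum_(j < m.+2) row (L i) (j%:Z - 1) * cf i j
  - X (-2) * \sum_(i < m.+2) \sum_(j < m.+2) (~~ (L i).1)%:R * row (L i) j%:Z * cf i j).
  rewrite !mulr_sumr -big_split -!sumrB; apply: eq_bigr => i _.
  rewrite !mulr_sumr -big_split -!sumrB; apply: eq_bigr => j _ /=.
  rewrite D1_row /r /e; case: (L i) => b s /=.
  rewrite !intrD !intrN -pmulrn.
  by case: b => /=; ring.
rewrite (sum_lcof_row p q _ _ r) (colshift_bot p q0 qN _ (fun j => j%:R - 2%:R) L0 L1).
rewrite (sum_lcof_rowshift p q _ _ (-2) (fun i => r i - X 0 * e i)).
rewrite (sum_lcof_col p q _ _ (fun j => j%:R)) (colshift1_bot p q0 qN _ L0).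
rewrite (sum_lcof_row p q _ _ (fun i => (~~ (L i).1)%:R)) /rowsum /colsum -/r -/e.
by ring.
Qed.

Lemma sum_det_down m (L : nat -> label) : L 0%N = (false, 0) -> L 1%N = (false, 1) ->
  \sum_(i < m.+2) det m.+2 (lupd L i (lshift 2 (L i))) =
  (q 2 *+ 2 - q 1 ^+ 2) * det m.+2 L.
Proof.
move=> L0 L1.
have := sum_lcof_rowshift p q m.+1 L (-2) (fun=> 1).
rewrite (colshift_bot p q0 qN _ (fun=> 1) L0 L1).
under [in X in _ = X -> _]eq_bigr do rewrite mul1r.
by move=> <-; ring.
Qed.

End LabelledDerivatives.

(** * Replacing, moving and stripping rows *)

Section RowMoves.
Variables (F : fieldType) (p q : int -> F).
Implicit Types (L : nat -> label) (l : label).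
Local Notation row := (lrow p q).
Local Notation det := (ldet p q).

Lemma ldet_plucker m L i k x y : det m.+1 L != 0 -> (i <= m)%N -> (k <= m)%N ->
  i != k ->
  det m.+1 L * det m.+1 (lupd (lupd L k y) i x) =
  det m.+1 (lupd L i x) * det m.+1 (lupd L k y)
  - det m.+1 (lupd L k x) * det m.+1 (lupd L i y).
Proof.
move=> L0 im km ik.
have ne : inord i != inord k :> 'I_m.+1 by rewrite -val_eqE /= !inordK.
have := @det_plucker _ _ _ _ _ (fun j : 'I_m.+1 => row x j%:Z)
   (fun j : 'I_m.+1 => row y j%:Z) L0 ne.
have ordE (z : nat) : (z <= m)%N -> forall r : 'I_m.+1,
    (r == inord z) = (r == z :> nat).
  by move=> zm r; rewrite -val_eqE /= inordK.
have updE z t : (z <= m)%N -> det m.+1 (lupd L z t) = \det (\matrix_(r, s)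
    if r == inord z then row t s%:Z else lmx p q m.+1 L r s).
  move=> zm; congr (\det _); apply/matrixP => r s; rewrite !mxE /lupd ordE //.
  by case: ifP.
rewrite /= !updE // => <-.
congr (_ * \det _); apply/matrixP => r s; rewrite !mxE /lupd !ordE //.
by do 2 case: ifP => //.
Qed.

(** Carries row [s] past the next [k] rows, to relate a replaced row to its place in the staircase
    order. *)
Definition lrot s k L : nat -> label := fun i =>
  if (i < s)%N then L i else if (i < s + k)%N then L i.+1
  else if i == (s + k)%N then L s else L i.

Lemma ldet_rot M s k L : (s + k < M)%N ->
  det M (lrot s k L) = (-1) ^+ k * det M L.
Proof.
elim: k => [|k IH] skM.
  rewrite expr0 mul1r; apply: ldet_ext => i _; rewrite /lrot addn0.
  by case: ltngtP => // ->.
have sk : (s + k < M)%N by lia.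
have sk1 : ((s + k).+1 < M)%N by lia.
rewrite exprS -mulrA -IH // mulN1r.
rewrite -(@det_row_swap _ _ _ (Ordinal sk) (Ordinal sk1)); last first.
  by rewrite -val_eqE /= neq_ltn leqnn.
congr (\det _); apply/matrixP => i j; rewrite !mxE; congr (row _ _).
rewrite /lrot addnS.
case: perm.tpermP => [->|->|/eqP n1 /eqP n2] /=.
- have -> : (s + k < s)%N = false by lia.
  have -> : ((s + k).+1 < s)%N = false by lia.
  have -> : ((s + k).+1 < s + k)%N = false by lia.
  by rewrite ltnSn [_ == _]gtn_eqF.
- have -> : ((s + k).+1 < s)%N = false by lia.
  have -> : (s + k < s)%N = false by lia.
  by rewrite !ltnn !eqxx.
have {}n1 : (i == s + k :> nat)%N = false by apply: negbTE.
have {}n2 : (i == (s + k).+1 :> nat)%N = false by apply: negbTE.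
have -> : (i < (s + k).+1)%N = (i < s + k)%N by move/negbT: n1; lia.
by rewrite n1 n2.
Qed.

Lemma ldet_strip_bot M L : q 0 = 1 -> (forall k, k < 0 -> q k = 0) ->
  L 0%N = (false, 0) ->
  det M.+1 L = det M (fun i => lshift (-1) (L i.+1)).
Proof.
move=> q0 qN L0; rewrite /ldet (expand_det_row _ ord0) big_ord_recl big1.
  rewrite addr0 mxE L0 /lrow /= subrr q0 mul1r /cofactor expr0 mul1r.
  congr (\det _); apply/matrixP => i j; rewrite !mxE lrow_shift !lift0.
  by congr (row _ _); lia.
by move=> j _; rewrite mxE L0 /lrow /= qN ?mul0r //; rewrite /bump /=; lia.
Qed.

Lemma ldet_strip_top M L : p 0 = 1 -> (forall k, k < 0 -> p k = 0) ->
  L M = (true, M%:Z) -> det M.+1 L = det M L.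
Proof.
move=> p0 pN LM; rewrite /ldet (expand_det_row _ ord_max) big_ord_recr /= big1.
  rewrite add0r mxE /= LM /lrow /= subrr p0 mul1r /cofactor /= addnn -signr_odd odd_double.
  rewrite expr0 mul1r.
  congr (\det _); apply/matrixP => i j; rewrite !mxE.
  by rewrite !lift_max.
by move=> j _; rewrite mxE /= LM /lrow /= pN ?mul0r //; have := ltn_ord j; lia.
Qed.

End RowMoves.

(** * Pairs of staircases and their four neighbours *)

Section StaircaseLabels.
Variables (F : fieldType) (p q : int -> F).
Hypothesis p0 : p 0 = 1.
Hypothesis pN : forall k, k < 0 -> p k = 0.
Hypothesis q0 : q 0 = 1.
Hypothesis qN : forall k, k < 0 -> q k = 0.
Local Notation row := (lrow p q).
Local Notation det := (ldet p q).

(* [stairlab a b] are the rows of the universal character of two staircases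
   with a - 1 and b - 1 steps, each partition being padded with one zero part;
   [padlab a b] has a second zero part on each side.  The first convention makes
   sense for a = 0 or b = 0, where it gives the character for a = 1 or b = 1. *)
Definition stairlab (a b i : nat) : label :=
  if (i < a)%N then (false, i%:Z *+ 2) else (true, i%:Z *+ 2 - (a + b)%N%:Z + 1).
Definition padlab (a b i : nat) : label :=
  if i == 0%N then (false, 0) else if (i <= a)%N then (false, i%:Z *+ 2 - 1)
  else if (i <= a + b)%N then (true, i%:Z *+ 2 - (a + b)%N%:Z)
  else (true, (a + b).+1%:Z).

Definition stairdet (a b : nat) : F := det (a + b) (stairlab a b).

Lemma padlab_det a b : det (a + b).+2 (padlab a b) = stairdet a b.
Proof.
rewrite ldet_strip_top //; last by rewrite /padlab /= !ifF //; lia.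
rewrite ldet_strip_bot //; apply: ldet_ext => i iab; rewrite /padlab /stairlab /=.
rewrite iab; case: ifP => _; congr (_, _) => /=; lia.
Qed.

(** Stripping the zero parts leaves the unpadded determinant, which sees only [a.-1] and [b.-1]. So
    indices 0 and 1 give the same value, as the reflection [ufun] demands at the edge. *)
Lemma stairdet_core a b : stairdet a b =
  \det (\matrix_(i < a.-1 + b.-1, j < a.-1 + b.-1)
    if (i < a.-1)%N then q (i%:Z *+ 2 + 1 - j%:Z)
    else p (j%:Z - (i%:Z *+ 2 - (a.-1 + b.-1)%N%:Z))).
Proof.
pose core a b i : label := if (i < a)%N then (false, i%:Z *+ 2 + 1)
  else (true, i%:Z *+ 2 - (a + b)%N%:Z).
transitivity (det (a.-1 + b.-1) (core a.-1 b.-1)); last first.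
  congr (\det _); apply/matrixP => i j; rewrite !mxE /core.
  by case: ifP.
case: a => [|a].
  case: b => [|b]; first by rewrite /stairdet /ldet !det_mx00.
  rewrite /stairdet add0n ldet_strip_top //; last first.
    by rewrite /stairlab /=; congr (_, _); lia.
  apply: ldet_ext => i _; rewrite /stairlab /core /=.
  by congr (_, _); lia.
case: b => [|b].
  rewrite /stairdet addn0 ldet_strip_bot //= [in RHS]addn0; apply: ldet_ext => i ia.
  rewrite /stairlab /core ltnS ia.
  by congr (_, _) => /=; lia.
rewrite /stairdet addSn ldet_strip_bot // addnS ldet_strip_top //; last first.
  rewrite /stairlab ifF /lshift /=; last by lia.
  by congr (_, _); lia.
apply: ldet_ext => i ia; rewrite /stairlab /core ltnS /lshift.
by case: ifP => _; congr (_, _) => /=; lia.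
Qed.

Section Neighbours.
Variables a b : nat.
Local Notation m := (a.+1 + b.+1)%N.
Local Notation L := (padlab a.+1 b.+1).
Local Notation P0 := (true, a%:Z - b%:Z).

(** [P0] continues the [p] labels downwards in steps of 2, and the largest [q] label disappears. *)
Lemma padlab_down_up : det m.+2 (lupd L a.+1 P0) = stairdet a b.+2.
Proof.
have e : (a + b.+2)%N = m by lia.
rewrite -padlab_det e; apply: ldet_ext => i im; rewrite /lupd /padlab e.
by do ?case: ifP => ?; congr (_, _); lia.
Qed.

Lemma padlab_up_down :
  det m.+2 (lupd L a.+2 (false, a%:Z *+ 2 + 3%:R)) = stairdet a.+2 b.
Proof.
have e : (a.+2 + b)%N = m by lia.
rewrite -padlab_det e; apply: ldet_ext => i im; rewrite /lupd /padlab e.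
by do ?case: ifP => ?; congr (_, _); lia.
Qed.

(** [P0] replaces a zero part, so the [q] labels start at 1, as in the longer staircase once its own
    zero part is stripped. The sign comes from moving the new row past the a + 1 remaining [q]
    rows. *)
Lemma padlab_up_up : det m.+2 (lupd L 0%N P0) =
  (-1) ^+ a.+1 * stairdet a.+2 b.+2.
Proof.
have am : (0 + a.+1 < m.+2)%N by lia.
have e : (a.+2 + b.+2)%N = m.+2 by lia.
have := ldet_rot p q (lupd L 0%N P0) am.
move=> h; apply: (mulfI (expf_neq0 a.+1 (_ : -1 != 0 :> F))).
  by rewrite oppr_eq0 oner_neq0.
rewrite -h mulrA -expr2 sqrr_sign mul1r /stairdet e.
rewrite ldet_strip_top //; last first.
  by rewrite /lrot /lupd /padlab; do ?case: ifP => ?; congr (_, _); lia.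
rewrite [RHS]ldet_strip_bot //.
apply: ldet_ext => i im; rewrite /lrot /lupd /padlab /stairlab /lshift e.
by do ?case: ifP => ?; congr (_, _) => /=; lia.
Qed.

(** With the new label the [q] rows 0, 1, 2 can be stripped one after another, and the labels 3, 5,
    ... become 0, 2, ... . *)
Lemma padlab_down_down : det m.+2 (lupd L a.+2 (false, 2)) =
  (-1) ^+ a * stairdet a b.
Proof.
(* The labels in sorted order, with 2 placed before 3, 5, ..., 2a + 1. *)
pose T i : label := if (i < 3)%N then (false, i%:Z) else
  if (i <= a.+2)%N then (false, i%:Z *+ 2 - 3%:R) else L i.
have am : (2 + a < m.+2)%N by lia.
transitivity (det m.+2 (lrot 2 a T)).
  apply: ldet_ext => i im; rewrite /lrot /lupd /T /padlab.
  by do ?case: ifP => ?; congr (_, _); lia.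
rewrite ldet_rot //; congr (_ * _).
have e : m = (a + b).+2 by lia.
rewrite e ldet_strip_top //; last first.
  by rewrite /T /padlab; do ?case: ifP => ?; congr (_, _); lia.
do 3 rewrite ldet_strip_bot //.
apply: ldet_ext => i im; rewrite /T /padlab /stairlab /lshift e.
by do ?case: ifP => ?; congr (_, _) => /=; lia.
Qed.

End Neighbours.
End StaircaseLabels.

(** * The Toda equations *)

Section TodaEquations.
Variables (F : fieldType) (X : int -> F) (D1 D2 : F -> F).
Hypothesis ch0 : forall k, k.+1%:R != 0 :> F.
Hypothesis derD1 : derivation D1.
Hypothesis derD2 : derivation D2.
Hypothesis D1X : forall k : int, D1 (X k) = k%:~R * (X k - X (k - 2)).
Hypothesis D2X : forall k : int, D2 (X k) = k%:~R * (X (k + 2) - X k).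

Local Notation p := (complete X).
Local Notation q := (complete (fun k => X (- k))).
Local Notation row := (lrow p q).
Local Notation det := (ldet p q).
Local Notation tau := (stairdet p q).

Let p0 : p 0 = 1. Proof. exact: complete0. Qed.
Let pN k : k < 0 -> p k = 0. Proof. exact: completeN. Qed.
Let q0 : q 0 = 1. Proof. exact: complete0. Qed.
Let qN k : k < 0 -> q k = 0. Proof. exact: completeN. Qed.

Lemma sum_padlab (G : label -> F) a b :
  \sum_(i < (a + b).+2) G (padlab a b i) =
  G (false, 0) + \sum_(i < a) G (false, i%:Z *+ 2 + 1)
  + \sum_(i < b) G (true, i%:Z *+ 2 + (a%:Z - b%:Z + 2)) + G (true, (a + b).+1%:Z).
Proof.
rewrite big_ord_recr big_ord_recl big_split_ord /= addrA; congr (_ + _ + _ + _).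
- apply: eq_bigr => i _; congr (G _); rewrite /padlab /bump /= add1n ltn_ord.
  by congr (_, _); lia.
- apply: eq_bigr => i _; congr (G _); rewrite /padlab /bump /=.
  by have ib := ltn_ord i; do ?case: ifP => ?; congr (_, _); lia.
by congr (G _); rewrite /padlab /= !ifF //; lia.
Qed.

Lemma colsumE n : colsum F n *+ 2 = n%:R * (n%:R - 1).
Proof.
elim: n => [|n IH]; first by rewrite /colsum big_ord0 mul0r mul0rn.
rewrite /colsum big_ord_recr /= mulrnDl IH -natr1; by ring.
Qed.

Lemma arith_sum n (c : int) :
  \sum_(i < n) (i%:Z *+ 2 + c)%:~R = n%:R * (n%:R - 1) + n%:R * c%:~R :> F.
Proof.
elim: n => [|n IH]; first by rewrite big_ord0 !mul0r addr0.
by rewrite big_ord_recr /= IH -natr1 intrD [_ *+ 2]mulr2n intrD -pmulrn; ring.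
Qed.

Section Fixed.
Variables a b : nat.
Local Notation m := (a.+1 + b.+1)%N.
Local Notation L := (padlab a.+1 b.+1).
Local Notation P0 := (true, a%:Z - b%:Z).
Local Notation Q1 := (false, a%:Z *+ 2 + 3%:R).
Local Notation Q0 := (false, 2).
Local Notation A := (a.+1%:R : F).
Local Notation B := (b.+1%:R : F).
Local Notation La := (lupd L a.+2 P0).
Local Notation S := (det m.+2 L).
Local Notation al := (det m.+2 La).
Local Notation shift M := (rowsum F m.+2 M - colsum F m.+2).

Lemma padlab_shift : shift L *+ 2 = (A - B) * (A + B - 1).
Proof.
rewrite mulrnBl colsumE /rowsum (sum_padlab (fun l => (l.2)%:~R)) /=.
rewrite !arith_sum !intrD !intrN -!pmulrn.
rewrite -[m.+2%:R]natr1 -[m.+1%:R]natr1 natrD.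
by ring.
Qed.

Lemma padlab_countP : \sum_(i < m.+2) (L i).1%:R = B + 1.
Proof.
rewrite (sum_padlab (fun l => l.1%:R)) /= !big1_eq !sumr_const card_ord.
by rewrite -natr1; ring.
Qed.

Lemma padlab_countQ : \sum_(i < m.+2) (~~ (L i).1)%:R = A + 1.
Proof.
rewrite (sum_padlab (fun l => (~~ l.1)%:R)) /= !big1_eq !sumr_const card_ord.
by rewrite -natr1; ring.
Qed.

Let Ltop : L m.+1 = (true, m.+1%:Z).
Proof. by rewrite /padlab /= !ifF //; lia. Qed.
Let Ltop2 : L m = (true, m%:Z).
Proof. by rewrite /padlab; do ?case: ifP => ?; congr (_, _); lia. Qed.
Let L0 : L 0%N = (false, 0). Proof. by []. Qed.
Let L1 : L 1%N = (false, 1). Proof. by []. Qed.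
Let LaE : L a.+2 = (true, a%:Z - b%:Z + 2).
Proof. by rewrite /padlab; do ?case: ifP => ?; congr (_, _); lia. Qed.
Let LbE : L a.+1 = (false, a%:Z *+ 2 + 1).
Proof. by rewrite /padlab; do ?case: ifP => ?; congr (_, _); lia. Qed.

(** For i < 2 the lowered [q] label is negative and the row vanishes; otherwise the row repeats the
    preceding one. The exceptions are the first [p] row and the last zero part. *)
Lemma padlab_up0 i : (i < m.+2)%N -> i != a.+2 -> i != m.+1 ->
  det m.+2 (lupd L i (lshift (-2) (L i))) = 0.
Proof.
move=> im ia i1; have [i2|i2] := leqP i 1.
  apply: ldet_upd0; first by lia.
  move=> j _; rewrite /lrow /lshift /padlab.
  by case: i {im ia i1} i2 => [|[|i]] //= _; rewrite qN //; lia.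
have -> : lshift (-2) (L i) = L i.-1.
  by rewrite /lshift /padlab; do ?case: ifP => ?; congr (_, _) => /=; lia.
by apply: ldet_upd_row; lia.
Qed.

(** The raised row repeats the next one, or, for the last two rows, its label exceeds every column
    index. The exceptions are the first zero part and the last [q] row. *)
Lemma padlab_down0 i : (i < m.+2)%N -> i != 0%N -> i != a.+1 ->
  det m.+2 (lupd L i (lshift 2 (L i))) = 0.
Proof.
move=> im i0 ia; have [i2|i2] := leqP m i.
  apply: ldet_upd0; first by lia.
  have -> : L i = (true, i%:Z).
    by rewrite /padlab; do ?case: ifP => ?; congr (_, _); lia.
  by move=> j jm; rewrite /lrow /= pN //; lia.
have -> : lshift 2 (L i) = L i.+1.
  by rewrite /lshift /padlab; do ?case: ifP => ?; congr (_, _) => /=; lia.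
by apply: ldet_upd_row; lia.
Qed.

Lemma padlab_raised_down0 i : (i < m.+2)%N -> i != 0%N -> i != a.+1 -> i != a.+2 ->
  det m.+2 (lupd La i (lshift 2 (La i))) = 0.
Proof.
move=> im i0 ia ia'; have [i2|i2] := leqP m i.
  apply: ldet_upd0; first by lia.
  have -> : La i = (true, i%:Z).
    by rewrite /lupd /padlab; do ?case: ifP => ?; congr (_, _); lia.
  by move=> j jm; rewrite /lrow /= pN //; lia.
have -> : lshift 2 (La i) = La i.+1.
  by rewrite /lshift /lupd /padlab; do ?case: ifP => ?; congr (_, _) => /=; lia.
by apply: ldet_upd_row; lia.
Qed.

Let am : (a.+2 < m.+2)%N. Proof. by lia. Qed.

(** Two row shifts survive, and [sum_det_up] trades the one in the last row for the other; 2B - 1 is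
    the difference m + 1 - (a - b + 2) of their labels. *)
Lemma D2_tau : D2 S = (B *+ 2 - 1) * al
  + (shift L - X 1 ^+ 2 / 2 - (B - 1 / 2) * X 2) * S.
Proof.
have shP : lshift (-2) (L a.+2) = P0 by rewrite LaE /lshift /= addrK.
have sumE := sum_det_up X Ltop Ltop2.
rewrite (@sum_ord2 F _ (fun i => det m.+2 (lupd L i (lshift (-2) (L i)))) a.+2 m.+1)
  // in sumE; try lia; last first.
  by move=> i im ia i1; apply: padlab_up0.
rewrite (D2_det ch0 derD2 D2X Ltop Ltop2) padlab_countP.
rewrite (@sum_ord2 F _ (fun i => (((L i).2)%:~R + X 0 * (~~ (L i).1)%:R)
      * det m.+2 (lupd L i (lshift (-2) (L i)))) a.+2 m.+1) //; try lia; last first.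
  by move=> i im ia i1; rewrite padlab_up0 ?mulr0.
rewrite shP in sumE *; move/(canRL (addKr _)): sumE => ->.
rewrite LaE Ltop /=.
have p2 : p 2 = (X 2 + X 1 ^+ 2) / 2.
  by rewrite -complete2 // mulrAC divff ?mul1r //; apply: (ch0 1).
rewrite p2 complete1 // !intrD intrN -!pmulrn.
rewrite -[m.+3%:R]natr1 -[m.+2%:R]natr1 -[m.+1%:R]natr1 natrD.
rewrite -[a.+1%:R]natr1 -[b.+1%:R]natr1.
by field; apply: (ch0 1).
Qed.

Local Notation low := (q 2 *+ 3 - q 1 ^+ 2 - shift L - X (-1) * q 1 - X (-2) * (A + 1)).
Local Notation det1 L' := (det m.+2 (lupd L' a.+1 Q1)).
Local Notation det0 L' := (det m.+2 (lupd L' 0%N Q0)).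

(** The shift of row 0 is weighted by its label 0 and drops out; 2A - 1 is the label of row a +
    1. *)
Lemma D1_tau : D1 S = (A *+ 2 - 1) * det1 L + low * S.
Proof.
have sh1 : lshift 2 (L a.+1) = Q1 by rewrite LbE /lshift; congr (_, _) => /=; ring.
rewrite (D1_det ch0 derD1 D1X _ L0 L1) padlab_countQ.
rewrite (@sum_ord2 F _ (fun i => (((L i).2)%:~R - X 0 * (L i).1%:R)
      * det m.+2 (lupd L i (lshift 2 (L i)))) 0%N a.+1) //; try lia; last first.
  by move=> i im ia i1; rewrite padlab_down0 ?mulr0.
rewrite sh1 LbE /= intrD [_%:Z *+ 2]mulr2n intrD -pmulrn -natr1.
by ring.
Qed.

Lemma sum_down_tau : det0 L + det1 L = (q 2 *+ 2 - q 1 ^+ 2) * S.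
Proof.
have sh1 : lshift 2 (L a.+1) = Q1 by rewrite LbE /lshift; congr (_, _) => /=; ring.
rewrite -(sum_det_down X _ L0 L1).
rewrite (@sum_ord2 F _ (fun i => det m.+2 (lupd L i (lshift 2 (L i)))) 0%N a.+1) //;
  try lia; last by move=> i im ia i1; rewrite padlab_down0.
by rewrite sh1.
Qed.

Let La0 : La 0%N = (false, 0). Proof. by []. Qed.
Let La1 : La 1%N = (false, 1). Proof. by []. Qed.

Let sh1a : lshift 2 (La a.+1) = Q1.
Proof.
by rewrite /lupd ifF ?LbE /lshift; [congr (_, _) => /=; ring | lia].
Qed.

Let Ssh : det m.+2 (lupd La a.+2 (lshift 2 (La a.+2))) = S.
Proof.
apply: ldet_ext => i _; rewrite /lupd eqxx.
by case: eqP => // ->; rewrite LaE.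
Qed.

(** In row a + 2 the shift undoes the earlier one and returns [S]. That earlier shift lowered the
    sum of labels by 2, whence the extra 2 in front of [al]. *)
Lemma D1_al : D1 al = (A *+ 2 - 1) * det1 La + (A - B - X 0) * S
  + (low + 2) * al.
Proof.
rewrite (D1_det ch0 derD1 D1X _ La0 La1).
rewrite (@sum_ord3 F _ (fun i => (((La i).2)%:~R - X 0 * (La i).1%:R)
      * det m.+2 (lupd La i (lshift 2 (La i)))) 0%N a.+1 a.+2) //; try lia; last first.
  by move=> i im ia i1 i2; rewrite padlab_raised_down0 ?mulr0.
have -> : \sum_(i < m.+2) (~~ (La i).1)%:R = A + 1.
  rewrite -padlab_countQ; apply: eq_bigr => i _; rewrite /lupd.
  by case: eqP => // ->; rewrite LaE.
have /(canRL (subrK _))-> : rowsum F m.+2 La - rowsum F m.+2 L = - 2.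
  rewrite /rowsum -sumrB.
  rewrite (@sum_ord1 F _ (fun i => ((La i).2)%:~R - ((L i).2)%:~R) a.+2) //.
    by rewrite /lupd eqxx LaE /= !intrD; ring.
  by move=> i _ /negbTE ia; rewrite /lupd ia subrr.
rewrite sh1a Ssh La0.
have -> : La a.+1 = (false, a%:Z *+ 2 + 1) by rewrite /lupd ifF //; lia.
have -> : La a.+2 = P0 by rewrite /lupd eqxx.
rewrite /= !intrD intrN -!pmulrn.
rewrite -[a.+1%:R]natr1 -[b.+1%:R]natr1.
by ring.
Qed.

Lemma sum_down_al : det0 La + det1 La + S = (q 2 *+ 2 - q 1 ^+ 2) * al.
Proof.
rewrite -(sum_det_down X _ La0 La1).
rewrite (@sum_ord3 F _ (fun i => det m.+2 (lupd La i (lshift 2 (La i)))) 0%N a.+1 a.+2) //;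
  try lia; last by move=> i im ia i1 i2; rewrite padlab_raised_down0.
by rewrite sh1a Ssh.
Qed.

Hypothesis S0 : tau a.+1 b.+1 != 0.

Let SE : S = tau a.+1 b.+1. Proof. exact: padlab_det. Qed.

(** [det1 La] differs from [S] in two rows; the mixed replacements in the Pluecker relation are the
    two neighbours. *)
Lemma plucker_cross : S * det1 La = al * det1 L - tau a b.+2 * tau a.+2 b.
Proof.
have -> : det1 La = det m.+2 (lupd (lupd L a.+1 Q1) a.+2 P0).
  apply: ldet_ext => i _; rewrite /lupd.
  by do ?case: ifP => // ?; exfalso; lia.
rewrite ldet_plucker ?SE //; try lia.
by rewrite padlab_down_up // padlab_up_down.
Qed.

Lemma plucker_diag : S * det0 La = al * det0 L + tau a.+2 b.+2 * tau a b.
Proof.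
have -> : det0 La = det m.+2 (lupd (lupd L 0%N Q0) a.+2 P0).
  apply: ldet_ext => i _; rewrite /lupd.
  by do ?case: ifP => // ?; exfalso; lia.
rewrite ldet_plucker ?SE //; try lia.
rewrite padlab_up_up // padlab_down_down // exprS mulN1r.
(* The signs (-1)^(a+1) and (-1)^a multiply to -1, which turns the difference into a sum. *)
have := sqrr_sign F a; move: ((-1) ^+ a) => e e2.
rewrite -[X in _ = _ + X]mul1r -e2.
by ring.
Qed.

(** The bilinear form of f^2 (D1 - 2)(D2 f / f). *)
Definition hirota (f : F) := f * D1 (D2 f) - D1 f * D2 f - 2 * f * D2 f.

(** Subtract [al] times the column-shift relation for [S] from [S] times the one for [al]: the
    scalars cancel, and the two Pluecker relations evaluate the rest. *)
Lemma toda_rel : tau a b.+2 * tau a.+2 b - tau a.+2 b.+2 * tau a b = tau a.+1 b.+1 ^+ 2.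
Proof.
have e1 := plucker_cross; have e2 := plucker_diag.
have s1 := sum_down_tau; have s2 := sum_down_al.
rewrite -SE.
have -> : S ^+ 2 = S * (det0 La + det1 La + S) - S * det0 La - S * det1 La by ring.
rewrite s2 e1 e2.
have -> : S * ((q 2 *+ 2 - q 1 ^+ 2) * al) = al * (det0 L + det1 L) by rewrite s1; ring.
by ring.
Qed.

(** By [D2_tau] the second-order part of [hirota] becomes S D1(al) - al D1(S) plus scalars. There
    [low] cancels, the remaining 2 S al is compensated by the -2 in [hirota], and the [det1] terms
    combine as in [plucker_cross]. *)
Lemma toda_cross :
  hirota (tau a.+1 b.+1) + (- (X 1 * X (-1)) + (A - B) ^+ 2) * tau a.+1 b.+1 ^+ 2 =
  - (A *+ 2 - 1) * (B *+ 2 - 1) * (tau a b.+2 * tau a.+2 b).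
Proof.
have D1c : D1 (shift L - X 1 ^+ 2 / 2 - (B - 1 / 2) * X 2) =
    X 1 * X (-1) - X 1 ^+ 2 - (B *+ 2 - 1) * (X 2 - X 0).
  have nn (n : nat) : D1 n%:R = 0 by apply: der_nat.
  have half : D1 (2^-1) = 0 by rewrite derV // nn oppr0 mul0r.
  have c0 : D1 (shift L) = 0.
    rewrite (derB derD1) /rowsum /colsum !(der_sum derD1) [Y in Y - _]big1 => [|i _].
      by rewrite big1 ?subr0 // => i _; apply: der_nat.
    exact: (der_int derD1).
  move: (shift L) c0 => c c0.
  rewrite !(derB derD1) c0 expr2 !(derM derD1) !(derB derD1) half nn (derM derD1) half (der1 derD1).
  rewrite !D1X.
  have -> : 2 - 2 = 0 :> int by [].
  have -> : 1 - 2 = -1 :> int by [].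
  by field; apply: (ch0 1).
rewrite -SE /hirota.
have e : D1 (D2 S) = (B *+ 2 - 1) * D1 al
   + D1 (shift L - X 1 ^+ 2 / 2 - (B - 1 / 2) * X 2) * S
   + (shift L - X 1 ^+ 2 / 2 - (B - 1 / 2) * X 2) * D1 S.
  rewrite D2_tau; move: (shift L - _ - _) => g; rewrite (derD_add derD1) !(derM derD1) -[B *+ 2]mulr_natr (derB derD1 (B * 2)) (derM derD1 B).
  rewrite (der1 derD1) !(der_nat derD1).
  by ring.
rewrite e D1c D2_tau D1_al D1_tau.
have cE : shift L = (A - B) * (A + B - 1) / 2.
  by rewrite -padlab_shift -[shift L *+ 2]mulr_natr mulfK //; apply: (ch0 1).
have pl := plucker_cross.
have pl' : tau a b.+2 * tau a.+2 b = al * det1 L - S * det1 La by rewrite pl; ring.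
rewrite pl' cE.
by field; apply: (ch0 1).
Qed.

(** The constants differ by (A + B - 1)^2 - (A - B)^2 = (2A - 1)(2B - 1), the coefficient with which
    [toda_rel] enters. *)
Lemma toda_diag :
  hirota (tau a.+1 b.+1) + (- (X 1 * X (-1)) + (A + B - 1) ^+ 2) * tau a.+1 b.+1 ^+ 2 =
  - (A *+ 2 - 1) * (B *+ 2 - 1) * (tau a.+2 b.+2 * tau a b).
Proof.
have h := toda_cross; have r := toda_rel.
have -> : tau a.+2 b.+2 * tau a b = tau a b.+2 * tau a.+2 b - tau a.+1 b.+1 ^+ 2.
  by rewrite -r; ring.
have -> : - (A *+ 2 - 1) * (B *+ 2 - 1) *
   (tau a b.+2 * tau a.+2 b - tau a.+1 b.+1 ^+ 2) =
   - (A *+ 2 - 1) * (B *+ 2 - 1) * (tau a b.+2 * tau a.+2 b)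
   + (A *+ 2 - 1) * (B *+ 2 - 1) * tau a.+1 b.+1 ^+ 2 by ring.
by rewrite -h; ring.
Qed.

End Fixed.
End TodaEquations.

(** * Normalisation and reflection to integer indices *)

Definition dfacts (u : nat) : nat := \prod_(1 <= j < u.+1) dfact (2 * j - 1).
Definition tri (v : nat) : nat := (v * v.+1) %/ 2.

Lemma triE v : (tri v * 2 = v * v.+1)%N.
Proof.
rewrite /tri divnK // dvdn2 oddM /=; by case: (odd v).
Qed.

Lemma dfactS n : dfact n.+2 = (n.+2 * dfact n)%N.
Proof. by []. Qed.

Lemma dfactsS u : dfacts u.+1 = (dfacts u * dfact (2 * u + 1))%N.
Proof.
by rewrite /dfacts big_nat_recr //; congr (_ * dfact _)%N; lia.
Qed.

Lemma dfacts_nb u : (dfacts u.+1 * dfacts u.-1 = (2 * u + 1) * dfacts u ^ 2)%N.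
Proof.
case: u => [|u]; first by rewrite dfactsS /dfacts big_geq.
rewrite !dfactsS (_ : 2 * u.+1 + 1 = (2 * u + 1).+2)%N; last by lia.
by rewrite dfactS /=; ring.
Qed.

(** [ufun] is 0 at both 0 and 1, so at k = 1 the truncated predecessor is the correct value. *)
Lemma ufun_pos (k : int) : 0 < k ->
  [/\ ufun (k + 1) = (ufun k).+1, ufun (k - 1) = (ufun k).-1 &
      k = (ufun k)%:Z + 1].
Proof.
by rewrite /ufun => k0; split; do ?case: ifP => ?; lia.
Qed.

Lemma ufun_neg (k : int) : (0 < k) = false ->
  [/\ ufun (k - 1) = (ufun k).+1, ufun (k + 1) = (ufun k).-1 &
      k = - (ufun k)%:Z].
Proof.
by rewrite /ufun => k0; split; do ?case: ifP => ?; lia.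
Qed.

Section NormalisedTau.
Variables (F : fieldType) (X : int -> F) (D1 D2 : F -> F).
Hypothesis ch0 : forall k, k.+1%:R != 0 :> F.
Hypothesis derD1 : derivation D1.
Hypothesis derD2 : derivation D2.
Hypothesis D1X : forall k : int, D1 (X k) = k%:~R * (X k - X (k - 2)).
Hypothesis D2X : forall k : int, D2 (X k) = k%:~R * (X (k + 2) - X k).
Variables w g : F.
Hypothesis w0 : w != 0.
Hypothesis D2w : D2 w = g * w.
Hypothesis D1g : D1 g = 2 * g.

Local Notation p := (complete X).
Local Notation q := (complete (fun k => X (- k))).
Local Notation tau := (stairdet p q).
Hypothesis tau0 : forall a b, tau a.+1 b.+1 != 0.

Definition potential (f : F) : F :=
  D1 (D2 f / f) - 2 * (D2 f / f) - X 1 * X (-1).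

Definition toda_step (c : int) (f : F) : F :=
  w * (potential f + c%:~R ^+ 2) * f ^+ 2.

Lemma stairdet_pred a b : tau a.-1.+1 b.-1.+1 = tau a b.
Proof.
have p0 : p 0 = 1 by exact: complete0.
have pN k : k < 0 -> p k = 0 by exact: completeN.
have q0 : q 0 = 1 by exact: complete0.
have qN k : k < 0 -> q k = 0 by exact: completeN.
by rewrite (stairdet_core p0 pN q0 qN) [RHS](stairdet_core p0 pN q0 qN).
Qed.

Definition weight (u v : nat) : F :=
  (-1) ^+ tri v * w ^+ tri v * (dfacts u)%:R * (dfacts v)%:R.
Definition ntau (u v : nat) : F := weight u v * tau v.+1 u.+1.

Lemma dfacts_neq0 u : (dfacts u)%:R != 0 :> F.
Proof.
have df n : (0 < dfact n)%N.
  have [k] := ubnP n; elim: k n => // k IH [|[|n]] // nk.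
  by rewrite dfactS muln_gt0 /= IH //; lia.
have : (0 < dfacts u)%N by rewrite /dfacts prodn_cond_gt0.
by case: (dfacts u).
Qed.

Lemma weight_neq0 u v : weight u v != 0.
Proof.
by rewrite !mulf_neq0 ?expf_neq0 ?dfacts_neq0 // oppr_eq0 oner_neq0.
Qed.

Lemma ntau_neq0 u v : ntau u v != 0.
Proof. by rewrite mulf_neq0 ?weight_neq0. Qed.

Lemma weight_split u v : weight u v =
  (- w) ^+ tri v * ((dfacts u)%:R * (dfacts v)%:R).
Proof. by rewrite /weight -exprMn mulN1r mulrA. Qed.

(** The second difference of the triangular numbers is 1, which leaves one factor -w; the double
    factorials supply the Toda coefficients. *)
Lemma weight_diag u v : weight u.+1 v.+1 * weight u.-1 v.-1 =
  - w * (u.+1%:R *+ 2 - 1) * (v.+1%:R *+ 2 - 1) * weight u v ^+ 2.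
Proof.
have e : (tri v.+1 + tri v.-1 = (tri v * 2).+1)%N.
  have := triE v.+1; have := triE v.-1; have := triE v.
  by case: v => [|v] /=; nia.
have nb n : (dfacts n.+1)%:R * (dfacts n.-1)%:R
     = (n.+1%:R *+ 2 - 1) * (dfacts n)%:R ^+ 2 :> F.
  by rewrite -natrM dfacts_nb natrM natrX natrD natrM -natr1; ring.
rewrite !weight_split mulrACA -exprD e [X in _ * X]mulrACA !nb exprS exprM.
by ring.
Qed.

(** The weight is a function of [u] times a function of [v], so exchanging [v.+1] and [v.-1] does
    not alter the product. *)
Lemma weight_cross u v : weight u.+1 v.-1 * weight u.-1 v.+1 =
  - w * (u.+1%:R *+ 2 - 1) * (v.+1%:R *+ 2 - 1) * weight u v ^+ 2.
Proof.
rewrite -weight_diag !weight_split.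
by ring.
Qed.

Lemma der_log_mul (D : F -> F) f h : derivation D -> f != 0 -> h != 0 ->
  D (f * h) / (f * h) = D f / f + D h / h.
Proof. by move=> dD f0 h0; rewrite (derM dD); field; rewrite f0 h0. Qed.

(** The weight adds [tri v] times [g] to the logarithmic derivative, and D1 - 2 kills [g]. *)
Lemma potential_weight u v f : f != 0 ->
  potential (weight u v * f) = potential f.
Proof.
move=> f0; rewrite /potential der_log_mul ?weight_neq0 //.
have -> : D2 (weight u v) / weight u v = (tri v)%:R * g.
  rewrite weight_split; set c := _%:R * _%:R.
  have c0 : c != 0 by rewrite mulf_neq0 ?dfacts_neq0.
  have Dc : D2 c = 0.
    by rewrite /c (derM derD2) !(der_nat derD2) mulr0 mul0r addr0.
  have nw0 : - w != 0 by rewrite oppr_eq0.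
  rewrite der_log_mul ?expf_neq0 // Dc mul0r addr0 (derX derD2) (derN derD2) D2w.
  case: (tri v) => [|k]; first by rewrite !mul0r.
  rewrite /= exprS; have := expf_neq0 k nw0; move: ((- w) ^+ k) => z z0.
  by field; rewrite nw0 z0.
rewrite (derD_add derD1) (derM derD1) (der_nat derD1) D1g.
by ring.
Qed.

Lemma potential_hirota f : f != 0 ->
  (potential f) * f ^+ 2 = hirota D1 D2 f - X 1 * X (-1) * f ^+ 2.
Proof.
move=> f0; rewrite /potential /hirota (derM derD1) (derV derD1).
by field.
Qed.

Lemma toda_step_weight c u v f : f != 0 ->
  toda_step c (weight u v * f) = w * weight u v ^+ 2 *
  (hirota D1 D2 f + (- (X 1 * X (-1)) + c%:~R ^+ 2) * f ^+ 2).
Proof.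
move=> f0; rewrite /toda_step potential_weight //.
have -> : hirota D1 D2 f = potential f * f ^+ 2 + X 1 * X (-1) * f ^+ 2.
  by rewrite potential_hirota //; ring.
by ring.
Qed.

Lemma ntau_diag u v (c : int) : c ^+ 2 = (u + v + 1)%N%:Z ^+ 2 ->
  toda_step c (ntau u v) = ntau u.+1 v.+1 * ntau u.-1 v.-1.
Proof.
move=> cE; have c2 : c%:~R ^+ 2 = (v.+1%:R + u.+1%:R - 1) ^+ 2 :> F.
  rewrite -rmorphXn cE rmorphXn -!natr1 /= -pmulrn !natrD; by ring.
rewrite toda_step_weight // c2 (toda_diag ch0 derD1 derD2 D1X D2X (tau0 _ _)).
rewrite /ntau (stairdet_pred v u) [RHS]mulrACA weight_diag.
by ring.
Qed.

Lemma ntau_cross u v (c : int) : c ^+ 2 = (u%:Z - v%:Z) ^+ 2 ->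
  toda_step c (ntau u v) = ntau u.+1 v.-1 * ntau u.-1 v.+1.
Proof.
move=> cE; have c2 : c%:~R ^+ 2 = (v.+1%:R - u.+1%:R) ^+ 2 :> F.
  rewrite -rmorphXn cE rmorphXn rmorphB -!natr1 /= -!pmulrn; by ring.
rewrite toda_step_weight // c2 (toda_cross ch0 derD1 derD2 D1X D2X (tau0 _ _)).
rewrite /ntau -(stairdet_pred v u.+2) -(stairdet_pred v.+2 u) /=.
by rewrite [RHS]mulrACA weight_cross; ring.
Qed.

Definition ztau (k l : int) : F := ntau (ufun k) (ufun l).

(** A step of +1 lengthens the staircase for a positive index and shortens it otherwise. So this is
    [ntau_diag] when k and l lie on the same side of 1/2, and [ntau_cross] when they do not. *)
Lemma ztau_diag (k l : int) :
  toda_step (k + l - 1) (ztau k l) = ztau (k + 1) (l + 1) * ztau (k - 1) (l - 1).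
Proof.
rewrite /ztau; case k0: (0 < k); [have [e1 e2 e3] := ufun_pos k0 | have [e1 e2 e3] := ufun_neg k0];
 (case l0: (0 < l); [have [f1 f2 f3] := ufun_pos l0 | have [f1 f2 f3] := ufun_neg l0]);
 rewrite e1 e2 f1 f2.
- by apply: ntau_diag; rewrite {1}e3 {1}f3 !PoszD; ring.
- by apply: ntau_cross; rewrite {1}e3 {1}f3; ring.
- by rewrite [RHS]mulrC; apply: ntau_cross; rewrite {1}e3 {1}f3; ring.
by rewrite [RHS]mulrC; apply: ntau_diag; rewrite {1}e3 {1}f3 !PoszD; ring.
Qed.

Lemma ztau_cross (k l : int) :
  toda_step (l - k) (ztau k l) = ztau (k - 1) (l + 1) * ztau (k + 1) (l - 1).
Proof.
rewrite /ztau; case k0: (0 < k); [have [e1 e2 e3] := ufun_pos k0 | have [e1 e2 e3] := ufun_neg k0];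
 (case l0: (0 < l); [have [f1 f2 f3] := ufun_pos l0 | have [f1 f2 f3] := ufun_neg l0]);
 rewrite e1 e2 f1 f2.
- by rewrite [RHS]mulrC; apply: ntau_cross; rewrite {1}e3 {1}f3; ring.
- by rewrite [RHS]mulrC; apply: ntau_diag; rewrite {1}e3 {1}f3 !PoszD; ring.
- by apply: ntau_diag; rewrite {1}e3 {1}f3 !PoszD; ring.
by apply: ntau_cross; rewrite {1}e3 {1}f3; ring.
Qed.

End NormalisedTau.

(** * Universal characters of staircases *)

Section UnicharStaircase.
Variable F : fieldType.

Lemma eq_schurp (x x' : nat -> F) : x =1 x' -> schurp x =1 schurp x'.
Proof.
move=> e [k|k] //=; apply: eq_bigr => f _; apply: eq_bigr => j _.
by rewrite e.
Qed.

Lemma nth_stair u k : (k < u)%N -> nth 0%N (stair u) k = (u - k)%N.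
Proof.
by move=> ku; rewrite nth_rev ?size_iota // nth_iota; lia.
Qed.

(** Free variables for the sizes allow the matrix dimension to be changed to [u] and [v]. *)
Lemma unichar_mx (x y : nat -> F) lam mu l l' : size lam = l -> size mu = l' ->
  unichar x y lam mu = \det (\matrix_(i < l' + l, j < l' + l)
     if (i < l')%N then schurp y ((nth 0%N mu (l' - i.+1))%:Z + i%:Z - j%:Z)
     else schurp x ((nth 0%N lam (i - l'))%:Z - i%:Z + j%:Z)).
Proof. by move=> <- <-. Qed.

Lemma unichar_stair (X : int -> F) (x y : nat -> F) u v :
  (forall k : nat, x k = X k%:Z / k%:R) ->
  (forall k : nat, y k = X (- k%:Z) / k%:R) ->
  unichar x y (stair u) (stair v) =
  stairdet (complete X) (complete (fun k => X (- k))) v.+1 u.+1.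
Proof.
move=> xE yE; rewrite stairdet_core; try by [exact: complete0 | exact: completeN].
rewrite (@unichar_mx _ _ _ _ u v) ?size_rev ?size_iota //.
congr (\det _); apply/matrixP => i j; rewrite !mxE /=.
have im := ltn_ord i; rewrite /complete.
case: ifP => iv.
  rewrite (eq_schurp yE) nth_stair; last by lia.
  by congr (schurp _ _); lia.
rewrite (eq_schurp xE) nth_stair; last by lia.
by congr (schurp _ _); lia.
Qed.

End UnicharStaircase.

(** * Extending a derivation to the field of fractions *)

Section QuotientRule.
Variables (F : fieldType) (a b a' b' da db da' db' : F).
Hypotheses (b0 : b != 0) (b0' : b' != 0).

Lemma quotient_rule_add :
  ((da * b' + a * db' + (da' * b + a' * db)) * (b * b')
   - (a * b' + a' * b) * (db * b' + b * db')) / (b * b') ^+ 2 =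
  (da * b - a * db) / b ^+ 2 + (da' * b' - a' * db') / b' ^+ 2.
Proof. by field; rewrite b0 b0'. Qed.

Lemma quotient_rule_mul :
  ((da * a' + a * da') * (b * b') - (a * a') * (db * b' + b * db')) / (b * b') ^+ 2 =
  (da * b - a * db) / b ^+ 2 * (a' / b') + a / b * ((da' * b' - a' * db') / b' ^+ 2).
Proof. by field; rewrite b0 b0'. Qed.

End QuotientRule.

Section FractionDerivation.
Variables (R : idomainType) (d : R -> R).
Hypothesis dD : {morph d : a b / a + b}.
Hypothesis dM : forall a b, d (a * b) = d a * b + a * d b.

Local Notation "x %:F" := (@FracField.tofrac R x).

Definition fracder (f : {fraction R}) : {fraction R} :=
  let r := repr f in
  (d (frac r).1 * (frac r).2 - (frac r).1 * d (frac r).2)%:F / ((frac r).2 ^+ 2)%:F.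

Lemma fracE (f : {fraction R}) :
  f = (frac (repr f)).1%:F / (frac (repr f)).2%:F.
Proof.
have d0 : (frac (repr f)).2%:F != 0 by rewrite tofrac_eq0 denom_ratioP.
apply: (canRL (mulfK d0)).
rewrite -{1}[f]reprK; unlock FracField.tofrac; rewrite -[LHS]FracField.pi_mul.
apply/eqmodP; rewrite /= FracField.equivfE /FracField.mulf.
by rewrite !numden_Ratio ?mulr1 ?oner_neq0 ?denom_ratioP // mulrC.
Qed.

(** Independence of the representative: two presentations satisfy a e = n b, and differentiating
    this identity compares their quotient rules. *)
Lemma fracder_quot a b : b != 0 ->
  fracder (a%:F / b%:F) = (d a * b - a * d b)%:F / (b ^+ 2)%:F.
Proof.
move=> b0; rewrite /fracder; set f := a%:F / b%:F.
have := fracE f; have := @denom_ratioP _ (repr f).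
move: (frac (repr f)).1 (frac (repr f)).2 => n e e0 fE.
have [bF eF] : b%:F != 0 /\ e%:F != 0 by rewrite !tofrac_eq0.
have cross : a * e = n * b.
  apply/eqP; rewrite -tofrac_eq !tofracM; apply/eqP.
  by move/eqP: fE; rewrite /f eqr_div // => /eqP.
have dcross : d a * e + a * d e = d n * b + n * d b by rewrite -!dM cross.
apply/eqP; rewrite eqr_div ?tofrac_eq0 ?expf_neq0 // -!tofracM tofrac_eq; apply/eqP.
have -> : (d n * e - n * d e) * b ^+ 2 =
  (d n * b + n * d b) * (e * b) - (n * b) * (d b * e + b * d e) by ring.
rewrite -dcross -cross; ring.
Qed.

Lemma frac_quotP (f : {fraction R}) : exists a b, b != 0 /\ f = a%:F / b%:F.
Proof.
by exists (frac (repr f)).1, (frac (repr f)).2; rewrite denom_ratioP -fracE.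
Qed.

Lemma fracder_derivation : derivation fracder.
Proof.
split=> f h.
all: have [a [b [b0 ->]]] := frac_quotP f; have [a' [b' [b0' ->]]] := frac_quotP h.
all: have [bF bF'] : b%:F != 0 /\ b'%:F != 0 by rewrite !tofrac_eq0.
  rewrite addf_div // -!tofracM -tofracD !fracder_quot ?mulf_neq0 // !dD !dM.
  rewrite !(tofracD, tofracN, tofracM, tofracXn).
  exact: quotient_rule_add.
rewrite mulf_div -!tofracM !fracder_quot ?mulf_neq0 // !dM.
rewrite !(tofracD, tofracN, tofracM, tofracXn).
exact: quotient_rule_mul.
Qed.

Lemma fracder_tofrac a : fracder a%:F = (d a)%:F.
Proof.
have d1 : d 1 = 0.
  by apply: (addIr (d 1)); have := dM 1 1; rewrite !mulr1 mul1r add0r.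
have -> : a%:F = a%:F / 1%:F by rewrite tofrac1 divr1.
by rewrite fracder_quot ?oner_neq0 // d1 mulr0 subr0 mulr1 expr1n tofrac1 divr1.
Qed.

End FractionDerivation.

(** * Specialisation of fractions and nonvanishing *)

Section Specialisation.
Variables (R : idomainType) (F : fieldType) (phi : {rmorphism R -> F}).
Local Notation "x %:F" := (@FracField.tofrac R x).

(** [f] is regular at the point [phi] with value [c]; a relation, since evaluation does not extend
    to all fractions. *)
Definition special (f : {fraction R}) (c : F) :=
  exists a b, [/\ phi b != 0, f = a%:F / b%:F & c = phi a / phi b].

Lemma special_denom (b : R) : phi b != 0 -> b%:F != 0.
Proof.
by move=> pb; rewrite tofrac_eq0; apply: contraNneq pb => ->; rewrite rmorph0.
Qed.

Lemma special_tofrac a : special a%:F (phi a).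
Proof. by exists a, 1; rewrite rmorph1 tofrac1 !divr1 oner_neq0. Qed.

Lemma special0 : special 0 0.
Proof. by have := special_tofrac 0; rewrite tofrac0 rmorph0. Qed.

Lemma special1 : special 1 1.
Proof. by have := special_tofrac 1; rewrite tofrac1 rmorph1. Qed.

Lemma specialD f g c e : special f c -> special g e -> special (f + g) (c + e).
Proof.
move=> [a [b [b0 -> ->]]] [a' [b' [b0' -> ->]]].
have bF := special_denom b0; have bF' := special_denom b0'.
exists (a * b' + a' * b), (b * b').
by rewrite !addf_div // -!tofracM -tofracD -!rmorphM -rmorphD /= rmorphM mulf_neq0.
Qed.

Lemma specialM f g c e : special f c -> special g e -> special (f * g) (c * e).
Proof.
move=> [a [b [b0 -> ->]]] [a' [b' [b0' -> ->]]].
exists (a * a'), (b * b').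
by rewrite !mulf_div -!tofracM -!rmorphM /= rmorphM mulf_neq0.
Qed.

Lemma specialN f c : special f c -> special (- f) (- c).
Proof.
move=> [a [b [b0 -> ->]]]; exists (- a), b.
by rewrite !rmorphN /= !mulNr.
Qed.

Lemma specialV f c : c != 0 -> special f c -> special f^-1 c^-1.
Proof.
move=> c0 [a [b [b0 -> cE]]]; exists b, a; rewrite cE !invf_div; split=> //.
by apply: contraNneq c0 => pa; rewrite cE pa mul0r.
Qed.

Lemma specialX f c n : special f c -> special (f ^+ n) (c ^+ n).
Proof.
by move=> h; elim: n => [|n IH]; rewrite ?exprS ?expr0; [exact: special1|exact: specialM].
Qed.

Lemma special_nat n : special n%:R n%:R.
Proof. by have := special_tofrac n%:R; rewrite !rmorph_nat. Qed.

Lemma special_neq0 f c : special f c -> c != 0 -> f != 0.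
Proof.
move=> [a [b [b0 -> ->]]] c0.
rewrite mulf_neq0 ?invr_neq0 ?special_denom //.
by apply: contraNneq c0 => ->; rewrite mul0r.
Qed.

Hypothesis ch0 : forall k, k.+1%:R != 0 :> F.

Lemma special_schurp (x : nat -> {fraction R}) (x' : nat -> F) k :
  (forall j, special (x j.+1) (x' j.+1)) -> special (schurp x k) (schurp x' k).
Proof.
move=> xs; case: k => [k|k]; last exact: special0.
apply: (big_ind2 special) => [||e _]; [exact: special0|by move=> *; apply: specialD|].
apply: (big_ind2 special) => [||j _]; [exact: special1|by move=> *; apply: specialM|].
apply: specialM; first exact: specialX.
apply: specialV; last exact: special_nat.
by have := fact_gt0 (e j); case: (_`!).
Qed.

Lemma special_unichar (x y : nat -> {fraction R}) (x' y' : nat -> F) lam mu :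
  (forall j, special (x j.+1) (x' j.+1)) -> (forall j, special (y j.+1) (y' j.+1)) ->
  special (unichar x y lam mu) (unichar x' y' lam mu).
Proof.
move=> xs ys; apply: (big_ind2 special) => [||s _];
  [exact: special0|by move=> *; apply: specialD|].
apply: specialM; first by apply/specialX/specialN/special1.
apply: (big_ind2 special) => [||i _]; [exact: special1|by move=> *; apply: specialM|].
by rewrite !mxE; case: ifP => _; apply: special_schurp.
Qed.

End Specialisation.

Section ConstantSpecialisation.
Variables (F : fieldType) (x : F).
Hypothesis ch0 : forall k, k.+1%:R != 0 :> F.
Hypothesis xz : forall z : int, - (x * x) + z%:~R ^+ 2 != 0.
Local Notation X := (fun _ : int => x).
Local Notation tau := (stairdet (complete X) (complete (fun k => X (- k)))).

(** The cross equation runs along the two edges, where a neighbour of index 0 equals the one of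
    index 1; the diagonal equation then reaches the interior. *)
Lemma stairdet_const_neq0 a b : tau a.+1 b.+1 != 0.
Proof.
have der : derivation (fun _ : F => 0) by split=> [c e|c e] /=; rewrite ?(mul0r, mulr0) addr0.
have D1X (k : int) : 0 = k%:~R * (X k - X (k - 2)) :> F by rewrite subrr mulr0.
have D2X (k : int) : 0 = k%:~R * (X (k + 2) - X k) :> F by rewrite subrr mulr0.
have hir f : hirota (fun _ : F => 0) (fun _ : F => 0) f = 0.
  by rewrite /hirota !mulr0 !subr0.
have dg c e h := toda_diag ch0 der der D1X D2X (a := c) (b := e) h.
have cr c e h := toda_cross ch0 der der D1X D2X (a := c) (b := e) h.
have diag c e : tau c.+1 e.+1 != 0 -> tau c.+2 e.+2 != 0.
  move=> h; have := dg c e h; rewrite hir add0r.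
  have -> : (c.+1%:R + e.+1%:R - 1 : F) = (c + e).+1%:Z%:~R.
    by rewrite -pmulrn -!natr1 natrD; ring.
  apply: contra_eqN => /eqP->; rewrite mul0r mulr0.
  by rewrite mulf_neq0 ?expf_neq0.
have first_row e : tau 1%N e.+1 != 0.
  elim: e => [|e IH].
    rewrite stairdet_core; try by [exact: complete0 | exact: completeN].
    by rewrite det_mx00 oner_neq0.
  have := cr 0%N e IH; rewrite hir add0r.
  have -> : (1%:R - e.+1%:R : F) = (- e%:Z)%:~R.
    by rewrite intrN -pmulrn -!natr1; ring.
  rewrite -(stairdet_pred X 0 e.+2) /=.
  apply: contra_eqN => /eqP->; rewrite mul0r mulr0.
  by rewrite mulf_neq0 ?expf_neq0.
have first_col c : tau c.+1 1%N != 0.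
  elim: c => [|c IH]; first exact: first_row.
  have := cr c 0%N IH; rewrite hir add0r.
  have -> : (c.+1%:R - 1%:R : F) = (c%:Z)%:~R.
    by rewrite -pmulrn -!natr1; ring.
  rewrite -(stairdet_pred X c.+2 0) /=.
  apply: contra_eqN => /eqP->; rewrite !mulr0.
  by rewrite mulf_neq0 ?expf_neq0.
by elim: a b => [|a IH] [|b] //; apply: diag.
Qed.

End ConstantSpecialisation.

Lemma half_sqr_neq_int (z : int) :
  - ((- 2^-1) * (- 2^-1)) + z%:~R ^+ 2 != 0 :> rat.
Proof.
rewrite addrC subr_eq0 mulrNN; apply/eqP => e.
have : (z ^+ 2 * 4)%:~R = 1%:~R :> rat by rewrite intrM rmorphXn /= e.
by move/eqP; rewrite eqr_int => /eqP; lia.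
Qed.

(** * The vector fields on the variables t_i *)

Section GarnierVectorFields.
Variables (F : fieldType) (N : nat) (t th : 'I_N -> F) (kap : F).
Variable d : 'I_N -> F -> F.
Hypothesis ch0 : forall k, k.+1%:R != 0 :> F.
Hypothesis t0 : forall i, t i != 0.
Hypothesis derd : forall i, derivation (d i).
Hypothesis dt : forall i j, d i (t j) = (i == j)%:R.
Hypothesis dth : forall i j, d i (th j) = 0.
Hypothesis dkap : forall i, d i kap = 0.

Definition momentum (k : int) : F := - kap + \sum_i th i * t i ^ k.
Definition field1 (f : F) : F := \sum_i (t i ^+ 2 - 1) / t i * d i f.
Definition field2 (f : F) : F := \sum_i t i * (t i ^+ 2 - 1) * d i f.

Lemma derivation_comb (c : 'I_N -> F) :
  derivation (fun f => \sum_i c i * d i f).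
Proof.
split=> a b.
  by rewrite -big_split; apply: eq_bigr => i _; rewrite (derD_add (derd i)) mulrDr.
rewrite mulr_suml mulr_sumr -big_split; apply: eq_bigr => i _ /=.
by rewrite (derM (derd i)); ring.
Qed.

Lemma field1_der : derivation field1. Proof. exact: derivation_comb. Qed.
Lemma field2_der : derivation field2. Proof. exact: derivation_comb. Qed.

Lemma d_momentum i k : d i (momentum k) = k%:~R * (th i * (t i ^ k / t i)).
Proof.
rewrite /momentum (derD_add (derd i)) (derN (derd i)) dkap oppr0 add0r.
rewrite (der_sum (derd i)) (bigD1 i) //= big1 => [|j ji].
  rewrite (derM (derd i)) dth mul0r add0r (der_exprz (derd i)) // dt eqxx.
  by rewrite mulr1 addr0 mulrCA.
rewrite (derM (derd i)) dth mul0r add0r (der_exprz (derd i)) // dt eq_sym.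
by rewrite (negbTE ji) !mulr0.
Qed.

Lemma field1_momentum (k : int) :
  field1 (momentum k) = k%:~R * (momentum k - momentum (k - 2)).
Proof.
have -> : momentum k - momentum (k - 2) =
    \sum_i (th i * t i ^ k - th i * t i ^ (k - 2)).
  by rewrite sumrB /momentum opprD addrACA subrr add0r.
rewrite mulr_sumr; apply: eq_bigr => i _; rewrite d_momentum expfzDr //.
have := t0 i; move: (t i ^ k) => z ti0.
have -> : t i ^ (-2 : int) = (t i ^+ 2)^-1 by [].
by field.
Qed.

Lemma field2_momentum (k : int) :
  field2 (momentum k) = k%:~R * (momentum (k + 2) - momentum k).
Proof.
have -> : momentum (k + 2) - momentum k =
    \sum_i (th i * t i ^ (k + 2) - th i * t i ^ k).
  by rewrite sumrB /momentum opprD addrACA subrr add0r.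
rewrite mulr_sumr; apply: eq_bigr => i _; rewrite d_momentum expfzDr //.
have := t0 i; move: (t i ^ k) => z ti0.
have -> : t i ^ (2 : int) = t i ^+ 2 by [].
by field.
Qed.

Lemma field1_t i : field1 (t i) = (t i ^+ 2 - 1) / t i.
Proof.
rewrite /field1 (bigD1 i) //= big1 => [|j /negbTE ji].
  by rewrite dt eqxx mulr1 addr0.
by rewrite dt ji mulr0.
Qed.

Lemma field2_t i : field2 (t i) = t i * (t i ^+ 2 - 1).
Proof.
rewrite /field2 (bigD1 i) //= big1 => [|j /negbTE ji].
  by rewrite dt eqxx mulr1 addr0.
by rewrite dt ji mulr0.
Qed.

Lemma field2_prod : field2 (\prod_i t i) = (\sum_i (t i ^+ 2 - 1)) * \prod_i t i.
Proof.
apply: (big_ind2 (fun s r => field2 r = s * r)) => [|s r s' r' h h'|i _].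
- by rewrite (der1 field2_der) mul0r.
- by rewrite (derM field2_der) h h'; ring.
by rewrite field2_t mulrC.
Qed.

(** Together with [field2_prod], this makes sum_i (t_i^2 - 1) the [g] belonging to w = prod_i
    t_i. *)
Lemma field1_sum_sqr :
  field1 (\sum_i (t i ^+ 2 - 1)) = 2 * \sum_i (t i ^+ 2 - 1).
Proof.
rewrite (der_sum field1_der) mulr_sumr; apply: eq_bigr => i _.
rewrite (derB field1_der) (derX field1_der) (der1 field1_der) field1_t.
by have := t0 i => ti0; field.
Qed.

Lemma momentum_product :
  kap * \sum_i th i * (t i ^+ 2 + 1) / t i
  - 2^-1 * \sum_i \sum_j th i * th j * (t i ^+ 2 + t j ^+ 2) / (t i * t j)
  - kap ^+ 2 = - (momentum 1 * momentum (-1)).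
Proof.
pose a := \sum_i th i * t i; pose b := \sum_i th i / t i.
have -> : \sum_i th i * (t i ^+ 2 + 1) / t i = a + b.
  by rewrite -big_split; apply: eq_bigr => i _ /=; have ti0 := t0 i; field.
have -> : \sum_i \sum_j th i * th j * (t i ^+ 2 + t j ^+ 2) / (t i * t j) =
    2 * (a * b).
  (* Each summand splits by t_i / t_j + t_j / t_i. *)
  transitivity (a * b + b * a); last by ring.
  rewrite {1}/a {2}/b !mulr_suml -big_split; apply: eq_bigr => i _ /=.
  rewrite !mulr_sumr -big_split; apply: eq_bigr => j _ /=.
  by have ti0 := t0 i; have tj0 := t0 j; field; rewrite ti0 tj0.
have -> : momentum 1 = - kap + a.
  by congr (_ + _); apply: eq_bigr => i _; rewrite expr1z.
have -> : momentum (-1) = - kap + b.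
  by congr (_ + _); apply: eq_bigr => i _; rewrite exprN1.
by field; exact: (ch0 1).
Qed.

End GarnierVectorFields.

Lemma mulf_divK (F : fieldType) (a b : F) : a != 0 -> a * b / a = b.
Proof. by move=> a0; rewrite mulrC mulKf. Qed.

(** * The polynomials T_(m,n) in the field of rational functions *)

Section Garnier.
Variable N : nat.
Local Notation V := N.*2.+1.
Local Notation P := {mpoly rat[V]}.
Local Notation K := {fraction P}.
Local Notation t := (@tvar N).
Local Notation th := (@theta N).
Local Notation kap := (kinf N).

Lemma dfracE i : dfrac (N := N) i = fracder (mderiv (inord i)).
Proof. by []. Qed.

Lemma dfrac_der i : derivation (dfrac (N := N) i).
Proof.
rewrite dfracE; apply: fracder_derivation; first exact: mderivD.
exact: mderivM.
Qed.

Lemma dfrac_X (i : 'I_N) (k : nat) : (k < V)%N ->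
  dfrac i (FracField.tofrac ('X_(inord k) : P)) = (i == k :> nat)%:R.
Proof.
move=> kV; rewrite dfracE fracder_tofrac; last exact: mderivM.
rewrite mderivX mnm1E -val_eqE /= !inordK //; last first.
  by have := ltn_ord i; lia.
rewrite eq_sym; case: eqP => [e|_]; last by rewrite scale0r tofrac0.
rewrite scale1r (_ : (_ - _)%MM = 0%MM) ?mpolyX0 ?tofrac1 //.
by apply/mnmP => l; rewrite mnmBE e subnn mnm0E.
Qed.

Lemma tvar_neq0 i : t i != 0.
Proof.
rewrite tofrac_eq0; apply/eqP => /(congr1 (mcoeff U_(inord i))%MM)/eqP.
by rewrite mcoeffX eqxx mcoeff0 oner_eq0.
Qed.

Lemma dfrac_tvar i j : dfrac i (t j) = (i == j)%:R.
Proof. by rewrite dfrac_X //; have := ltn_ord j; lia. Qed.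

Lemma dfrac_theta i j : dfrac i (th j) = 0.
Proof.
have ? := ltn_ord i; have ? := ltn_ord j.
by rewrite dfrac_X ?ltn_eqF //; lia.
Qed.

Lemma dfrac_kinf i : dfrac i kap = 0.
Proof. by rewrite dfrac_X ?ltn_eqF //; lia. Qed.

Lemma frac_char0 k : k.+1%:R != 0 :> K.
Proof.
by rewrite -(rmorph_nat (@FracField.tofrac P)) tofrac_eq0 -mpolyC_nat mpolyC_eq0 pnatr_eq0.
Qed.

Local Notation X := (momentum t th kap).
Local Notation D1 := (field1 t (@dfrac N)).
Local Notation D2 := (field2 t (@dfrac N)).

Lemma Phi_potential (T : K) : Phi T = potential X D1 D2 T.
Proof.
rewrite /Phi /potential.
have -> : \sum_(i < N) t i * (t i ^+ 2 - 1) * (dfrac i T / T) = D2 T / T.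
  by rewrite mulr_suml; apply: eq_bigr => i _; rewrite mulrA.
have := momentum_product th kap frac_char0 tvar_neq0.
set A := kap * _; set B := 2^-1 * _; set G := D1 _ - _ => <-.
by rewrite !addrA.
Qed.

Lemma step_toda c (T : K) : step c T = toda_step X D1 D2 (\prod_(i < N) t i) c T.
Proof. by rewrite /step Phi_potential. Qed.

Definition base_point (i : 'I_V) : rat :=
  if (i < N)%N then 1 else if (i == N :> nat)%N then 2^-1 else 0.

Local Notation spec := (special (meval base_point)).

Lemma spec_X (k : nat) : (k < V)%N ->
  spec (FracField.tofrac ('X_(inord k) : P))
    (if (k < N)%N then 1 else if k == N then 2^-1 else 0).
Proof.
move=> kV; have := special_tofrac (meval base_point) ('X_(inord k) : P).
by rewrite /= mevalXU /base_point inordK.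
Qed.

Lemma spec_tvar i : spec (t i) 1.
Proof.
by have ? := ltn_ord i; have := @spec_X i; rewrite ltn_ord; apply; lia.
Qed.

Lemma spec_kinf : spec kap 2^-1.
Proof. by have := @spec_X N; rewrite ltnn eqxx; apply; lia. Qed.

Lemma spec_theta i : spec (th i) 0.
Proof.
have ? := ltn_ord i; have := @spec_X (N.+1 + i).
by rewrite !ifF; try lia; apply; lia.
Qed.

Lemma spec_theta_sum (f : 'I_N -> K) (c : 'I_N -> rat) :
  (forall i, spec (f i) (c i)) -> spec (\sum_i th i * f i) 0.
Proof.
move=> fc; have <- : \sum_i 0 * c i = 0 by rewrite big1 // => i _; rewrite mul0r.
apply: (big_ind2 spec) => [||i _]; [exact: special0|by move=> *; apply: specialD|].
by apply: specialM; first exact: spec_theta.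
Qed.

Lemma spec_div_nat (f : K) c k : spec f c -> spec (f / k.+1%:R) (c / k.+1%:R).
Proof.
by move=> fc; apply: specialM => //; apply: specialV; rewrite ?pnatr_eq0 //; apply: special_nat.
Qed.

Lemma spec_xs k : spec (xs N k.+1) (- 2^-1 / k.+1%:R).
Proof.
apply: spec_div_nat; rewrite -[- 2^-1]addr0; apply: specialD.
  exact/specialN/spec_kinf.
by apply: (@spec_theta_sum _ (fun=> 1 ^+ k.+1)) => i; apply: specialX; apply: spec_tvar.
Qed.

Lemma spec_ys k : spec (ys N k.+1) (- 2^-1 / k.+1%:R).
Proof.
apply: spec_div_nat; rewrite -[- 2^-1]addr0; apply: specialD.
  exact/specialN/spec_kinf.
apply: (@spec_theta_sum _ (fun=> 1^-1 ^+ k.+1)) => i; apply: specialX.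
by apply: specialV; [exact: oner_neq0 | exact: spec_tvar].
Qed.

Lemma xsE k : xs N k = X k%:Z / k%:R.
Proof. by []. Qed.

Lemma ysE k : ys N k = X (- k%:Z) / k%:R.
Proof.
rewrite /ys /momentum; congr ((_ + _) / _); apply: eq_bigr => i _.
by rewrite exprVn exprnN.
Qed.

Local Notation tau := (stairdet (complete X) (complete (fun k => X (- k)))).

Lemma tau_neq0 a b : tau a.+1 b.+1 != 0.
Proof.
rewrite -(unichar_stair b a xsE ysE).
have ch0 k : k.+1%:R != 0 :> rat by rewrite pnatr_eq0.
(* At the base point every [momentum] is -kappa = -1/2, for [xs] and [ys] alike. *)
pose x' k : rat := - 2^-1 / k%:R.
apply: (special_neq0 (special_unichar ch0 (x' := x') (y' := x') _ _ spec_xs spec_ys)).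
rewrite (@unichar_stair _ (fun=> - 2^-1)) //.
exact: stairdet_const_neq0 ch0 half_sqr_neq_int _ _.
Qed.

Local Notation z := (ztau X (\prod_(i < N) t i)).

Let zD k l : z k l != 0.
Proof.
apply: ntau_neq0 tau_neq0 _ _; first exact: frac_char0.
by apply/prodf_neq0 => i _; apply: tvar_neq0.
Qed.

Let w0 : \prod_(i < N) t i != 0.
Proof. by apply/prodf_neq0 => i _; apply: tvar_neq0. Qed.

Let d1der := field1_der t dfrac_der.
Let d2der := field2_der t dfrac_der.
Let d1X := field1_momentum tvar_neq0 dfrac_der dfrac_tvar dfrac_theta dfrac_kinf.
Let d2X := field2_momentum tvar_neq0 dfrac_der dfrac_tvar dfrac_theta dfrac_kinf.
Let d2w := field2_prod dfrac_der dfrac_tvar.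
Let d1g := field1_sum_sqr tvar_neq0 dfrac_der dfrac_tvar.

Lemma step_diag (k l : int) :
  step (k + l - 1) (z k l) = z (k + 1) (l + 1) * z (k - 1) (l - 1).
Proof.
rewrite step_toda.
exact: (ztau_diag frac_char0 d1der d2der d1X d2X w0 d2w d1g tau_neq0).
Qed.

Lemma step_cross (k l : int) :
  step (l - k) (z k l) = z (k - 1) (l + 1) * z (k + 1) (l - 1).
Proof.
rewrite step_toda.
exact: (ztau_cross frac_char0 d1der d2der d1X d2X w0 d2w d1g tau_neq0).
Qed.

(** Nonvanishing lets each division in [fwd] and [bwd] be cancelled, so the product identities
    identify the sequence. *)
Lemma bseqE (G : int -> K -> K) (y : int -> K) : (forall j, y j != 0) ->
  (forall j, G j (y j) = y (j + 1) * y (j - 1)) ->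
  forall j, Defs.bseq G (y 0) (y 1) j = y j.
Proof.
move=> y0 Gy.
have fwdE k : fwd G (y 0) (y 1) k = (y k%:Z, y k.+1%:Z).
  elim: k => [|k IH] //=; rewrite IH /= Gy; congr (_, _).
  have -> : k.+1%:Z + 1 = k.+2%:Z by lia.
  have -> : k.+1%:Z - 1 = k%:Z by lia.
  exact: (mulfK (y0 _)).
have bwdE k : bwd G (y 0) (y 1) k = (y (- k%:Z), y (1 - k%:Z)).
  elim: k => [|k IH] //=; rewrite IH /= Gy; congr (_, _).
    have -> : - k%:Z + 1 = 1 - k%:Z by lia.
    have -> : - k%:Z - 1 = - k.+1%:Z by lia.
    exact: (mulf_divK _ (y0 _)).
  by congr y; lia.
by case=> k; rewrite /Defs.bseq ?fwdE // bwdE NegzE.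
Qed.

Lemma ztau_unichar k l : z k l =
  weight (\prod_(i < N) t i) (ufun k) (ufun l) *
  unichar (xs N) (ys N) (stair (ufun k)) (stair (ufun l)).
Proof. by rewrite (unichar_stair _ _ xsE ysE). Qed.

Lemma unichar00 (x y : nat -> K) : unichar x y [::] [::] = 1.
Proof. exact: det_mx00. Qed.

Lemma unichar10 (x y : nat -> K) : unichar x y [:: 1%N] [::] = schurp x 1.
Proof. by rewrite /unichar det_mx11 mxE. Qed.

Lemma unichar01 (x y : nat -> K) : unichar x y [::] [:: 1%N] = schurp y 1.
Proof. by rewrite /unichar det_mx11 mxE. Qed.

Let dfacts0 : dfacts 0 = 1%N. Proof. by rewrite /dfacts big_geq. Qed.
Let dfacts1 : dfacts 1 = 1%N. Proof. by rewrite dfactsS dfacts0. Qed.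

Lemma ztau_trivial k l : ufun k = 0%N -> ufun l = 0%N -> z k l = 1.
Proof.
move=> k0 l0; rewrite ztau_unichar k0 l0 unichar00 /weight dfacts0.
by rewrite !expr0 !mulr1.
Qed.

Lemma ztau_T10 : z (-1) 1 = T10 N.
Proof.
rewrite ztau_unichar (_ : ufun (-1) = 1%N) // (_ : ufun 1 = 0%N) // unichar10.
rewrite /weight dfacts0 dfacts1 !expr0 !mulr1 mul1r (eq_schurp xsE).
rewrite -[schurp _ _]/(complete X 1) complete1; last exact: frac_char0.
by rewrite /momentum addrC.
Qed.

Lemma ztau_T11 : z 0 2 = T11 N.
Proof.
rewrite ztau_unichar (_ : ufun 0 = 0%N) // (_ : ufun 2 = 1%N) // unichar01.
rewrite /weight dfacts0 dfacts1 (_ : tri 1 = 1%N) // !expr1 !mulr1 mulN1r.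
rewrite (eq_schurp ysE) -[schurp _ _]/(complete (fun k => X (- k)) 1).
rewrite complete1; last exact: frac_char0.
by rewrite /T11 mulNr -mulrN /momentum opprD opprK.
Qed.

(** On the line n = 0 the recursion in [m] is the cross equation, with l - k = 2m. *)
Lemma Tcol0_ztau m : Tcol0 N m = z (- m) m.
Proof.
pose y (j : int) := z (- j) j.
have yE := @bseqE (fun j => @step N (2 * j)) y (fun j => zD (- j) j) _ m.
rewrite -[RHS]yE => [|j].
  by rewrite /Tcol0 /y oppr0 ztau_T10 ztau_trivial.
have -> : 2 * j = j - (- j) by lia.
rewrite step_cross; congr (z _ _ * z _ _); by lia.
Qed.

Lemma Tcol1_ztau m : Tcol1 N m = z (1 - m) (1 + m).
Proof.
pose y (j : int) := z (1 - j) (1 + j).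
have yE := @bseqE (fun j => @step N (2 * j)) y (fun j => zD _ _) _ m.
rewrite -[RHS]yE => [|j].
  by rewrite /Tcol1 /y ztau_trivial // -ztau_T11.
have -> : 2 * j = (1 + j) - (1 - j) by lia.
rewrite step_cross; congr (z _ _ * z _ _); by lia.
Qed.

(** A step in [n] moves both indices by 1, so the diagonal equation applies, with k + l - 1 = 2n -
    1. *)
Lemma Tmn_ztau m n : Tmn N m n = z (n - m) (n + m).
Proof.
pose y (j : int) := z (j - m) (j + m).
have yE := @bseqE (fun j => @step N (2 * j - 1)) y (fun j => zD _ _) _ n.
rewrite -[RHS]yE => [|j].
  by rewrite /Tmn Tcol0_ztau Tcol1_ztau /y !add0r.
have -> : 2 * j - 1 = (j - m) + (j + m) - 1 by lia.
rewrite step_diag; congr (z _ _ * z _ _); by lia.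
Qed.

End Garnier.

Theorem theorem3p5 (N : nat) (hN : (0 < N)%N) (m n : int) :
  Tmn N m n =
  Nmn N m n * unichar (xs N) (ys N) (stair (ufun (n - m))) (stair (ufun (n + m))).
Proof. by rewrite Tmn_ztau ztau_unichar. Qed.
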